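(* A circuit is erasable if and only if it is sequentializable. In particular, the circuit translation of every MALL proof is erasable.
   Context: Fix literals with an involution $a\mapsto\bar a$ ($\bar a\ne a$, $\bar{\bar a}=a$); MALL formulas are built from literals by $\otimes,⅋,\&,\oplus$; sequents are finite lists of formulas. MALL proofs use the rules: axiom $\vdash P,\bar P$ ($P$ a literal); permutation (from $A_1,\dots,A_n$ infer $A_{\sigma1},\dots,A_{\sigma n}$); $⅋$ (from $\Gamma,A,B$ infer $\Gamma,A⅋B$); $\oplus_i$, $i\in\{0,1\}$ (from $\Gamma,A_i$ infer $\Gamma,A_0\oplus A_1$); $\otimes$ (from $\Gamma,A$ and $B,\Delta$ infer $\Gamma,A\otimes B,\Delta$); $\&$ (from $\Gamma,A$ and $\Gamma,B$ infer $\Gamma,A\&B$). A circuit consists of a finite non-empty set of nodes and a finite set of wires; each wire is labelled by a formula, has a source node and possibly a target node distinct from the source; a wire with no target is an exit. Each node is of one of the kinds: axiom (source of two wires labelled by dual literals, target of none); contraction (target of two wires, source of one, all three with the same formula); binary of type $\otimes$, $⅋$ or $\&$ (target of a designated left wire labelled $A$ and right wire labelled $B$, source of one wire labelled $A\square B$ where $\square$ is its type); plus (target of one wire designated left or right, labelled $A$, source of one wire labelled $A\oplus B$ if left, $B\oplus A$ if right, for some $B$). The underlying undirected graph (nodes joined by wires) is connected, and the exits are linearly ordered; the list of exit formulas is the conclusion. A node is final if it is the source of an exit. A node $N$ is ready if it is final and: $N$ is a plus node; or $N$ is a $\otimes$ node and deleting $N$ (with its exit) leaves exactly two connected components; or $N$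 is a $⅋$ node and deleting $N$ leaves the circuit connected; or $N$ is a $\&$ node, every other final node is a contraction node, deleting all final nodes with their exits leaves exactly two connected components $X_1,X_2$, and every final node has one incoming wire in $X_1$ and the other in $X_2$; or $N$ is an axiom node and the only node. Deleting a node turns its incoming wires into exits. For ready $N$, $X\leadsto_N S$ where $S$ is the set of connected components obtained by deleting $N$ (in the $\&$ case: deleting all final nodes, giving $\{X_1,X_2\}$; in the axiom case $S=\emptyset$), each made into a circuit with an exit order induced from that of $X$. For finite sets of circuits, $T\leadsto U$ if $T=T'\cup\{X\}$ (disjoint), $X\leadsto_N S$ for some ready $N$, and $U=T'\cup S$. A circuit $X$ is erasable if $\{X\}\leadsto^*\emptyset$. Translation of a proof to a circuit, by induction: axiom $\vdash P,\bar P$ gives one axiom node with exits $P,\bar P$ in that order; permutation $\sigma$ permutes the exit order; $⅋$ adds a $⅋$ node targeted by the last two exits (the last one right), with new exit $A⅋B$ placed last; $\oplus_i$ adds a plus node targeted by the last exit (designated left if $i=0$, right if $i=1$), new exit $A_0\oplus A_1$ placed last; $\otimes$ takes the disjoint union of the two premise circuits, adds a $\otimes$ node targeted by the last exit of the first (left) and first exit of the second (right), with exit order: remaining exits of the first, then the new exit $A\otimes B$, then remaining exits of the second; $\&$ (premises $B_1,\dots,B_n,A_i$) takes the disjoint union, adds a $\&$ node targeted by the last exits (left from the first premise), and for each $j\le n$ a contraction node targeted by the $j$-th exits of both, with new exits ordered $B_1,\dots,B_n,A_0\&A_1$. A circuit is sequentializable if it is (isomorphic to) the translation of some proof. *)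

(* Defs.v *)
From mathcomp Require Import ssreflect ssrfun ssrbool eqtype ssrnat seq choice.
From mathcomp Require Import fintype finset fingraph tuple.

Set Implicit Arguments.
Unset Strict Implicit.
Unset Printing Implicit Defensive.

(* MALL formulas over a type L of literals (the involution is passed  *)
(* separately as [dual]).                                             *)
Inductive formula (L : Type) : Type :=
  | Lit of L
  | Tens of formula L & formula L
  | Par of formula L & formula L
  | With of formula L & formula L
  | Plus of formula L & formula L.
Arguments Lit {L}.
Arguments Tens {L}.
Arguments Par {L}.
Arguments With {L}.
Arguments Plus {L}.

Inductive proof (L : Type) (dual : L -> L) : seq (formula L) -> Type :=
  | pax (a : L) : proof dual [:: Lit a; Lit (dual a)]
  | pex (G : seq (formula L)) (p : seq nat) :
      perm_eq p (iota 0 (size G)) ->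
      proof dual G -> proof dual (pmap (onth G) p)
  | ppar (G : seq (formula L)) (A B : formula L) :
      proof dual (G ++ [:: A; B]) -> proof dual (G ++ [:: Par A B])
  | pplus (G : seq (formula L)) (A0 A1 : formula L) (i : bool) :
      proof dual (G ++ [:: if i then A1 else A0]) ->
      proof dual (G ++ [:: Plus A0 A1])
  | ptens (G D : seq (formula L)) (A B : formula L) :
      proof dual (G ++ [:: A]) -> proof dual (B :: D) ->
      proof dual (G ++ Tens A B :: D)
  | pwith (G : seq (formula L)) (A0 A1 : formula L) :
      proof dual (G ++ [:: A0]) -> proof dual (G ++ [:: A1]) ->
      proof dual (G ++ [:: With A0 A1]).

Inductive bintype := BTens | BPar | BWith.
Inductive nkind := NAx | NContr | NBin of bintype | NPlus.

Definition binf (L : Type) (t : bintype) (A B : formula L) : formula L :=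
  match t with BTens => Tens A B | BPar => Par A B | BWith => With A B end.

Record circuit (L : Type) := Circuit {
  node : finType;
  wire : finType;
  kind : node -> nkind;
  lab : wire -> formula L;
  src : wire -> node;
  tgt : wire -> option node;        (* None : the wire is an exit *)
  isleft : wire -> bool;            (* designation left (true) / right (false);
                                       only meaningful for wires entering a
                                       binary or plus node *)
  exits : seq wire                  (* the linear order of the exits *)
}.
Arguments Circuit {L}.
Arguments node {L} c.
Arguments wire {L} c.
Arguments kind {L} c _.
Arguments lab {L} c _.
Arguments src {L} c _.
Arguments tgt {L} c _.
Arguments isleft {L} c _.
Arguments exits {L} c.

Section CircuitDefs.
Variables (L : Type) (dual : L -> L) (C : circuit L).

Definition ins (v : node C) : {set wire C} := [set w | tgt C w == Some v].
Definition outs (v : node C) : {set wire C} := [set w | src C w == v].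

Definition wf_node (v : node C) : Prop :=
  match kind C v with
  | NAx => ins v = set0 /\
      exists w1 w2 a, w1 != w2 /\ outs v = [set w1; w2] /\
        lab C w1 = Lit a /\ lab C w2 = Lit (dual a)
  | NContr => exists w1 w2 o, w1 != w2 /\ ins v = [set w1; w2] /\
      outs v = [set o] /\ lab C w1 = lab C o /\ lab C w2 = lab C o
  | NBin t => exists wl wr o, ins v = [set wl; wr] /\
      isleft C wl /\ ~~ isleft C wr /\ outs v = [set o] /\
      lab C o = binf t (lab C wl) (lab C wr)
  | NPlus => exists w o B, ins v = [set w] /\ outs v = [set o] /\
      lab C o = (if isleft C w then Plus (lab C w) B else Plus B (lab C w))
  end.

Definition adj : rel (node C) := fun u v =>
  [exists w, ((src C w == u) && (tgt C w == Some v))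
          || ((src C w == v) && (tgt C w == Some u))].

Definition wf_circuit : Prop :=
  0 < #|node C| /\
  (forall w, tgt C w != Some (src C w)) /\
  uniq (exits C) /\
  (forall w, (w \in exits C) = (tgt C w == None)) /\
  (forall v, wf_node v) /\
  (forall u v, connect adj u v).

(* Every circuit produced from C by deleting nodes is determined by its  *)
(* node set S : its wires are those with source in S, a wire whose       *)
(* target is not in S becomes an exit.                                   *)
Definition adjS (S : {set node C}) : rel (node C) := fun u v =>
  [&& u \in S, v \in S & adj u v].
Definition comp (S : {set node C}) (u : node C) : {set node C} :=
  [set v in S | connect (adjS S) u v].
Definition comps (S : {set node C}) : {set {set node C}} :=
  [set comp S u | u in S].
Definition exitS (S : {set node C}) (w : wire C) : bool :=
  (src C w \in S) && (if tgt C w is Some v then v \notin S else true).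
Definition finals (S : {set node C}) : {set node C} :=
  [set v | [exists w, exitS S w && (src C w == v)]].

(* [ready_res S N R] : N is ready in the sub-circuit S, and S ~>_N R *)
Definition ready_res (S : {set node C}) (N : node C)
    (R : {set {set node C}}) : Prop :=
  N \in finals S /\
  match kind C N with
  | NAx => S = [set N] /\ R = set0
  | NContr => False
  | NPlus => R = comps (S :\ N)
  | NBin BTens => #|comps (S :\ N)| = 2 /\ R = comps (S :\ N)
  | NBin BPar => #|comps (S :\ N)| = 1 /\ R = comps (S :\ N)
  | NBin BWith =>
      (forall M, M \in finals S -> M != N -> kind C M = NContr) /\
      exists X1 X2, X1 != X2 /\ comps (S :\: finals S) = [set X1; X2] /\
        (forall M, M \in finals S -> exists w1 w2,
            tgt C w1 = Some M /\ tgt C w2 = Some M /\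
            src C w1 \in X1 /\ src C w2 \in X2) /\
        R = [set X1; X2]
  end.

Definition step (T U : {set {set node C}}) : Prop :=
  exists X N R, X \in T /\ ready_res X N R /\ U = (T :\ X) :|: R.

End CircuitDefs.

Inductive rtc (A : Type) (r : A -> A -> Prop) : A -> A -> Prop :=
  | rtc_refl x : rtc r x x
  | rtc_step x y z : r x y -> rtc r y z -> rtc r x z.

Definition erasable (L : Type) (C : circuit L) : Prop :=
  rtc (@step L C) [set setT] set0.

Definition designated (L : Type) (C : circuit L) (w : wire C) : bool :=
  if tgt C w is Some v then
    (match kind C v with NBin _ | NPlus => true | _ => false end)
  else false.

Definition circ_iso (L : Type) (C1 C2 : circuit L) : Prop :=
  exists (fN : node C1 -> node C2) (fW : wire C1 -> wire C2),
    bijective fN /\ bijective fW /\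
    (forall v, kind C2 (fN v) = kind C1 v) /\
    (forall w, lab C2 (fW w) = lab C1 w) /\
    (forall w, src C2 (fW w) = fN (src C1 w)) /\
    (forall w, tgt C2 (fW w) = omap fN (tgt C1 w)) /\
    (forall w, designated w -> isleft C2 (fW w) = isleft C1 w) /\
    exits C2 = map fW (exits C1).

Section Translation.
Variables (L : Type) (dual : L -> L).

Definition ax_circ (a : L) : circuit L :=
  @Circuit L unit bool (fun _ => NAx)
    (fun w => if w then Lit (dual a) else Lit a)
    (fun _ => tt) (fun _ => None) (fun _ => true) [:: false; true].

Definition perm_circ (p : seq nat) (C : circuit L) : circuit L :=
  @Circuit L (node C) (wire C) (kind C) (lab C) (src C) (tgt C)
    (isleft C) (pmap (onth (exits C)) p).

Definition par_circ (n : nat) (A B : formula L) (C : circuit L) : circuit L :=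
  @Circuit L (option (node C)) (option (wire C))
    (fun v => if v is Some v' then kind C v' else NBin BPar)
    (fun w => if w is Some w' then lab C w' else Par A B)
    (fun w => if w is Some w' then Some (src C w') else None)
    (fun w => if w is Some w' then
        let i := index w' (exits C) in
        if (i == n) || (i == n.+1) then Some None else omap Some (tgt C w')
      else None)
    (fun w => if w is Some w' then
        let i := index w' (exits C) in
        if i == n then true else if i == n.+1 then false else isleft C w'
      else true)
    (rcons [seq Some w | w <- take n (exits C)] None).

Definition plus_circ (n : nat) (A0 A1 : formula L) (b : bool) (C : circuit L)
  : circuit L :=
  @Circuit L (option (node C)) (option (wire C))
    (fun v => if v is Some v' then kind C v' else NPlus)
    (fun w => if w is Some w' then lab C w' else Plus A0 A1)
    (fun w => if w is Some w' then Some (src C w') else None)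
    (fun w => if w is Some w' then
        if index w' (exits C) == n then Some None else omap Some (tgt C w')
      else None)
    (fun w => if w is Some w' then
        if index w' (exits C) == n then ~~ b else isleft C w'
      else true)
    (rcons [seq Some w | w <- take n (exits C)] None).

Definition tens_circ (n : nat) (A B : formula L) (C1 C2 : circuit L)
  : circuit L :=
  @Circuit L (option (node C1 + node C2))%type (option (wire C1 + wire C2))%type
    (fun v => match v with
              | Some (inl v') => kind C1 v' | Some (inr v') => kind C2 v'
              | None => NBin BTens end)
    (fun w => match w with
              | Some (inl w') => lab C1 w' | Some (inr w') => lab C2 w'
              | None => Tens A B end)
    (fun w => match w with
              | Some (inl w') => Some (inl (src C1 w'))
              | Some (inr w') => Some (inr (src C2 w'))
              | None => None end)
    (fun w => match w with
              | Some (inl w') =>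
                  if index w' (exits C1) == n then Some None
                  else omap (fun x => Some (inl x)) (tgt C1 w')
              | Some (inr w') =>
                  if index w' (exits C2) == 0 then Some None
                  else omap (fun x => Some (inr x)) (tgt C2 w')
              | None => None end)
    (fun w => match w with
              | Some (inl w') =>
                  if index w' (exits C1) == n then true else isleft C1 w'
              | Some (inr w') =>
                  if index w' (exits C2) == 0 then false else isleft C2 w'
              | None => true end)
    ([seq Some (inl w) | w <- take n (exits C1)] ++
       None :: [seq Some (inr w) | w <- behead (exits C2)]).

Definition with_circ (G : seq (formula L)) (A0 A1 : formula L)
    (C1 C2 : circuit L) : circuit L :=
  let n := size G in
  @Circuit L (option ((node C1 + node C2) + 'I_n))%type
    ((wire C1 + wire C2) + option 'I_n)%type
    (fun v => match v with
              | Some (inl (inl v')) => kind C1 v'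
              | Some (inl (inr v')) => kind C2 v'
              | Some (inr _) => NContr
              | None => NBin BWith end)
    (fun w => match w with
              | inl (inl w') => lab C1 w'
              | inl (inr w') => lab C2 w'
              | inr (Some j) => tnth (in_tuple G) j
              | inr None => With A0 A1 end)
    (fun w => match w with
              | inl (inl w') => Some (inl (inl (src C1 w')))
              | inl (inr w') => Some (inl (inr (src C2 w')))
              | inr (Some j) => Some (inr j)
              | inr None => None end)
    (fun w => match w with
              | inl (inl w') =>
                  let i := index w' (exits C1) in
                  if i == n then Some None else
                  match (insub i : option 'I_n) with
                  | Some j => Some (Some (inr j))
                  | None => omap (fun x => Some (inl (inl x))) (tgt C1 w')
                  end
              | inl (inr w') =>
                  let i := index w' (exits C2) in
                  if i == n then Some None else
                  match (insub i : option 'I_n) with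
                  | Some j => Some (Some (inr j))
                  | None => omap (fun x => Some (inl (inr x))) (tgt C2 w')
                  end
              | inr _ => None end)
    (fun w => match w with
              | inl (inl w') =>
                  if index w' (exits C1) == n then true else isleft C1 w'
              | inl (inr w') =>
                  if index w' (exits C2) == n then false else isleft C2 w'
              | inr _ => true end)
    (rcons [seq inr (Some j) | j <- enum 'I_n] (inr None)).

Fixpoint translate (G : seq (formula L)) (pi : proof dual G) : circuit L :=
  match pi with
  | pax a => ax_circ a
  | pex G p _ pi1 => perm_circ p (translate pi1)
  | ppar G A B pi1 => par_circ (size G) A B (translate pi1)
  | pplus G A0 A1 b pi1 => plus_circ (size G) A0 A1 b (translate pi1)
  | ptens G D A B pi1 pi2 =>
      tens_circ (size G) A B (translate pi1) (translate pi2)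
  | pwith G A0 A1 pi1 pi2 => with_circ G A0 A1 (translate pi1) (translate pi2)
  end.

Definition sequentializable (C : circuit L) : Prop :=
  exists (G : seq (formula L)) (pi : proof dual G), circ_iso (translate pi) C.

End Translation.

(* Main.v *)
Require Import Defs.
From mathcomp Require Import ssreflect ssrfun ssrbool eqtype ssrnat seq choice.
From mathcomp Require Import fintype finset fingraph tuple.

(** Erasability of a family of subcircuits reduces to a well-founded notion on single
    node sets: [S] erases if some ready node leads from [S] to sets that all erase.
    Each rule of the calculus corresponds to one kind of ready node, so both
    directions are inductions that match the two.
    From erasable to sequentializable, the components left after deleting a ready
    node are again connected and closed under predecessors, hence by induction
    realized by proofs for every order of their exits; the rule of the deleted node
    glues these realizations. For a tensor, connectedness puts the two premises of
    the node in different components. For a &-node, each exit of a component enters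
    exactly one of the final nodes, which identifies the context of the two premises.
    Conversely, the node (or, for &, the layer of nodes) added by the last rule of a
    proof is ready, and deleting it leaves copies of the translations of the premises,
    along which erasability is transported. *)

Set Implicit Arguments.
Unset Strict Implicit.
Unset Printing Implicit Defensive.

(** * Erasability of a single subcircuit; connected components *)

Section Erasure.
Variables (L : Type) (C : circuit L).
Implicit Types (S T Y : {set node C}) (w : wire C).

(** A ready node with [R = set0], such as a lone axiom, is the base case. Single sets replace
    families because the members of a family are erased independently of each other. *)
Inductive erases : {set node C} -> Prop :=
  Erases S N R : ready_res S N R -> (forall Y, Y \in R -> erases Y) -> erases S.

(** Induction on the rewriting sequence: a member not chosen by the first step survives it, and the
    chosen one erases because all its results do. The equation on [U] keeps the endpoint a variable
    for the induction. *)
Lemma rtc_erases (T U : {set {set node C}}) :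
  rtc (@step L C) T U -> U = set0 -> forall X, X \in T -> erases X.
Proof.
elim=> [{}T -> X|{}T V {}U [X [N [R [XT [rdy ->]]]]] _ IH /IH {}IH Y YT]; first by rewrite inE.
have [->|YX] := eqVneq Y X.
  by apply: (Erases rdy) => Z ZR; apply: IH; rewrite inE ZR orbT.
by apply: IH; rewrite !inE YX YT.
Qed.

(* Adjoining an erasable circuit to a family that rewrites to the empty one keeps
   this property; unlike disjointness of the family, it survives the rewriting. *)
Lemma erases_rtcU1 S : erases S ->
  forall T : {set {set node C}}, rtc (@step L C) T set0 -> rtc (@step L C) (S |: T) set0.
Proof.
elim=> {}S N R rdy _ IH T rT.
(* Families are sets, so [S] may already be a member; otherwise removing it from [S |: T] gives back
   [T], as [step] requires. *)
have [ST|nST] := boolP (S \in T).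
  by suff -> : S |: T = T by []; apply/setUidPr; rewrite sub1set.
have rTR : rtc (@step L C) (T :|: R) set0.
  (* The members of [R] are adjoined one by one, each by its own induction hypothesis. *)
  rewrite -(set_enum R); set s := enum R.
  have: {subset s <= R} by move=> x; rewrite mem_enum.
  elim: s => [|Y s IHs] sub.
    by suff -> : T :|: [set x in [::]] = T by []; apply/setP=> x; rewrite !inE orbF.
  have -> : T :|: [set x in Y :: s] = Y |: (T :|: [set x in s]).
    by apply/setP=> x; rewrite !inE orbCA.
  apply: IH; first by apply: sub; rewrite inE eqxx.
  by apply: IHs => x xs; apply: sub; rewrite inE xs orbT.
apply: rtc_step rTR; exists S, N, R; split; first by rewrite setU11.
by split=> //; rewrite setU1K.
Qed.

Lemma erasableP : erasable C <-> erases setT.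
Proof.
split=> [r|e]; first by apply: (rtc_erases r) => //; rewrite inE.
rewrite /erasable -[[set setT]]setU0; apply: (erases_rtcU1 e); exact: rtc_refl.
Qed.

Lemma adj_sym : symmetric (@adj L C).
Proof. by move=> u v; apply: eq_existsb => w; rewrite orbC. Qed.

Lemma adjS_sym S : symmetric (adjS S).
Proof. by move=> u v; rewrite /adjS adj_sym andbCA. Qed.

Lemma connectS_sym S : connect_sym (adjS S).
Proof. exact: sym_connect_sym (adjS_sym S). Qed.

Lemma connectS_sub S T u v : S \subset T -> connect (adjS S) u v -> connect (adjS T) u v.
Proof.
move=> /subsetP ST; apply: connect_sub => x y /and3P[xS yS xy].
by apply: connect1; rewrite /adjS !ST.
Qed.

Lemma wire_adj w v : tgt C w = Some v -> adj (src C w) v.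
Proof. by move=> tw; apply/existsP; exists w; rewrite eqxx tw eqxx. Qed.

Lemma comp_refl S u : u \in S -> u \in Defs.comp S u.
Proof. by move=> uS; rewrite inE uS connect0. Qed.

Lemma comp_comps S u : u \in S -> Defs.comp S u \in comps S.
Proof. exact: imset_f. Qed.

Lemma comp_subset S u : Defs.comp S u \subset S.
Proof. by apply/subsetP=> x; rewrite inE => /andP[]. Qed.

Lemma comps_subset S Y : Y \in comps S -> Y \subset S.
Proof. by case/imsetP=> u _ ->; apply: comp_subset. Qed.

Lemma comps_eq S Y u : Y \in comps S -> u \in Y -> Y = Defs.comp S u.
Proof.
case/imsetP=> v vS ->; rewrite inE => /andP[uS vu].
apply/setP=> x; rewrite !inE; congr (_ && _).
by apply: (same_connect (connectS_sym S)).
Qed.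

Lemma comps_inj S Y Z u : Y \in comps S -> Z \in comps S -> u \in Y -> u \in Z -> Y = Z.
Proof. by move=> YS ZS uY uZ; rewrite (comps_eq YS uY) (comps_eq ZS uZ). Qed.

Lemma comps_adj S Y u v : Y \in comps S -> adj u v -> u \in Y -> v \in S -> v \in Y.
Proof.
move=> YS uv uY vS; rewrite (comps_eq YS uY) inE vS connect1 //.
by rewrite /adjS vS uv (subsetP (comps_subset YS)).
Qed.

(** Paths must stay inside [S]. Non-emptiness makes a connected set count as exactly one
    component. *)
Definition conn S := S != set0 /\ {in S &, forall u v, connect (adjS S) u v}.

(** A path inside [S] that starts in [Y] never leaves [Y], by [comps_adj], hence it is a path inside
    [Y]. *)
Lemma comps_conn S Y : Y \in comps S -> conn Y.
Proof.
move=> YS; split.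
  by case/imsetP: YS => u uS ->; apply/set0Pn; exists u; apply: comp_refl.
move=> u v uY vY; have Yu := comps_eq YS uY.
have uS := subsetP (comps_subset YS) _ uY.
have /connectP[p pth ->] : connect (adjS S) u v by move: vY; rewrite Yu inE => /andP[].
elim: p {vY} u uY {Yu uS} pth => [|x p IHp] u uY /=; first by rewrite connect0.
case/andP=> /and3P[uS xS ux] pth; have xY := comps_adj YS ux uY xS.
by apply: connect_trans (IHp x xY pth); apply: connect1; rewrite /adjS uY xY.
Qed.

Lemma conn1 u : conn [set u].
Proof.
split; first by apply/set0Pn; exists u; rewrite inE.
by move=> x y; rewrite !inE => /eqP-> /eqP->; rewrite connect0.
Qed.

Lemma connU S T u v : conn S -> conn T -> u \in S -> v \in T -> adj u v -> conn (S :|: T).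
Proof.
move=> [nS cS] [nT cT] uS vT uv.
have toU x : x \in S :|: T -> connect (adjS (S :|: T)) x u.
  rewrite inE => /orP[xS|xT]; first exact: connectS_sub (subsetUl _ _) (cS _ _ xS uS).
  apply: connect_trans (connectS_sub (subsetUr _ _) (cT _ _ xT vT)) _.
  by apply: connect1; rewrite /adjS !inE vT uS orbT /= adj_sym.
split; first by apply/set0Pn; exists u; rewrite inE uS.
move=> x y xU yU; apply: connect_trans (toU x xU) _.
by rewrite connectS_sym toU.
Qed.

(** Serves to attach the contraction nodes of a &-layer to the connected rest: every node outside
    [S] reaches it in one step. *)
Lemma conn_fringe S T : conn S -> S \subset T ->
  (forall x, x \in T -> x \notin S -> exists2 y, y \in S & adj x y) -> conn T.
Proof.
move=> [/set0Pn[c cS] con] ST fr.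
have toc x : x \in T -> connect (adjS T) x c.
  move=> xT; have [xS|nxS] := boolP (x \in S).
    exact: connectS_sub ST (con _ _ xS cS).
  have [y yS xy] := fr x xT nxS.
  apply: connect_trans (connectS_sub ST (con _ _ yS cS)).
  by apply: connect1; rewrite /adjS xT (subsetP ST).
split; first by apply/set0Pn; exists c; apply: (subsetP ST).
by move=> x y xT yT; apply: connect_trans (toc x xT) _; rewrite connectS_sym toc.
Qed.

(** Closure under adjacency keeps paths from leaving [Y], and connectedness lets them reach all of
    it. *)
Lemma comps_eq_conn S Y : conn Y -> Y \subset S ->
  (forall u v, u \in Y -> v \in S -> adj u v -> v \in Y) ->
  forall u, u \in Y -> Defs.comp S u = Y.
Proof.
move=> [_ cY] YS clY u uY; apply/setP=> v; rewrite inE; apply/andP/idP => [[vS uv]|vY].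
  have cl : closed (adjS S) (mem Y).
    move=> x y /and3P[xS yS xy]; apply/idP/idP => h; first exact: clY xy.
    by apply: clY h xS _; rewrite adj_sym.
  by rewrite -(closed_connect cl uv).
by split; [apply: (subsetP YS) | apply: connectS_sub YS (cY _ _ uY vY)].
Qed.

Lemma comps1 S : conn S -> comps S = [set S].
Proof.
move=> cS; have key u : u \in S -> Defs.comp S u = S by apply: comps_eq_conn.
have /set0Pn[u uS] := cS.1.
apply/setP=> Y; rewrite inE; apply/imsetP/eqP => [[v vS ->]|->]; first exact: key.
by exists u; rewrite ?key.
Qed.

Lemma comps2 S T : conn S -> conn T ->
  (forall u v, u \in S -> v \in T -> ~~ adj u v) -> comps (S :|: T) = [set S; T].
Proof.
move=> cS cT nadj.
have kS u : u \in S -> Defs.comp (S :|: T) u = S.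
  apply: comps_eq_conn => //; first exact: subsetUl.
  by move=> x y xS; rewrite inE => /orP[//|yT]; rewrite (negPf (nadj _ _ xS yT)).
have kT u : u \in T -> Defs.comp (S :|: T) u = T.
  apply: comps_eq_conn => //; first exact: subsetUr.
  by move=> x y xT; rewrite inE => /orP[yS|//]; rewrite adj_sym (negPf (nadj _ _ yS xT)).
have /set0Pn[s sS] := cS.1; have /set0Pn[t tT] := cT.1.
apply/setP=> Y; rewrite !inE; apply/imsetP/orP => [[u]|].
  by rewrite inE => /orP[/kS->|/kT->] ->; rewrite eqxx; [left|right].
case=> /eqP->; first by exists s; rewrite ?kS ?inE ?sS.
by exists t; rewrite ?kT ?inE ?tT ?orbT.
Qed.

End Erasure.

(** * Transport along embeddings *)

(* The last clause says that wires leaving the image are exactly the exits of [D]. *)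
Record embedding (L : Type) (D C : circuit L)
    (fN : node D -> node C) (fW : wire D -> wire C) : Prop := Embedding {
  emb_injN : injective fN;
  emb_injW : injective fW;
  emb_kind : forall v, kind C (fN v) = kind D v;
  emb_src : forall w, src C (fW w) = fN (src D w);
  emb_surjW : forall w v, src C w = fN v -> exists w', w = fW w';
  emb_tgt : forall w v, (tgt C (fW w) == Some (fN v)) = (tgt D w == Some v)
}.

Section Transport.
Variables (L : Type) (D C : circuit L).
Variables (fN : node D -> node C) (fW : wire D -> wire C).
Hypothesis E : embedding fN fW.
Implicit Types (T X Y : {set node D}).

Let injN := emb_injN E.

(** Adjacency is reflected as well as preserved, since a wire of [C] whose source is in the image
    comes from [D] by [emb_surjW]. *)
Lemma emb_adj u v : adj (fN u) (fN v) = adj u v.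
Proof.
apply/existsP/existsP => [[w]|[w wuv]]; last first.
  by exists (fW w); rewrite !(emb_src E) !(emb_tgt E) !(inj_eq injN).
case/orP=> /andP[/eqP sw tw]; have [w' ew] := emb_surjW E sw; subst w; exists w'.
  by move: tw; rewrite (emb_tgt E) => ->; rewrite -(inj_eq injN) -(emb_src E) sw eqxx.
by move: tw; rewrite (emb_tgt E) => ->; rewrite -!(inj_eq injN) -(emb_src E) sw eqxx orbT.
Qed.

Lemma emb_adjS T u v : adjS (fN @: T) (fN u) (fN v) = adjS T u v.
Proof. by rewrite /adjS !mem_imset // emb_adj. Qed.

Lemma emb_connect T u v : connect (adjS T) u v -> connect (adjS (fN @: T)) (fN u) (fN v).
Proof.
case/connectP=> p; elim: p u => [|x p IHp] u /= => [_ ->|/andP[ux pth] lst]; first exact: connect0.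
by apply: connect_trans (IHp x pth lst); apply: connect1; rewrite emb_adjS.
Qed.

Lemma emb_connect_inv T u y : connect (adjS (fN @: T)) (fN u) y ->
  exists2 v, y = fN v & connect (adjS T) u v.
Proof.
case/connectP=> p; elim: p u => [|x p IHp] u /= => [_ ->|/andP[ux pth] lst].
  by exists u.
have /imsetP[x' _ ex] : x \in fN @: T by case/and3P: ux.
subst x; have [v -> xv] := IHp x' pth lst; exists v => //.
by apply: connect_trans xv; apply: connect1; rewrite -emb_adjS.
Qed.

Lemma emb_comp T u : Defs.comp (fN @: T) (fN u) = fN @: Defs.comp T u.
Proof.
apply/setP=> y; apply/idP/idP => [|/imsetP[v]]; rewrite inE => /andP[].
  move=> yT /emb_connect_inv[v ey uv]; subst y.
  by move: yT; rewrite !mem_imset // inE => ->.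
by move=> vT uv ->; rewrite inE mem_imset // vT emb_connect.
Qed.

Lemma emb_comps T : comps (fN @: T) = (fun X => fN @: X) @: comps T.
Proof.
apply/setP=> Y; apply/imsetP/imsetP => [[y /imsetP[u uT ->] ->]|[X /imsetP[u uT ->] ->]].
  by exists (Defs.comp T u); rewrite ?emb_comp ?comp_comps.
by exists (fN u); rewrite ?emb_comp ?mem_imset.
Qed.

(** A wire with a target in [D] keeps it, up to [fN]; an exit of [D] may acquire a target in [C],
    but only outside the image. *)
Lemma emb_exitS T w : exitS (fN @: T) (fW w) = exitS T w.
Proof.
rewrite /exitS (emb_src E) mem_imset //; congr (_ && _).
have key := emb_tgt E w.
case tDw : (tgt D w) => [v|]; case tCw : (tgt C (fW w)) => [y|] //.
- have /eqP ey := key v; rewrite tCw tDw eqxx in ey.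
  by move/eqP: ey => /eqP[->]; rewrite mem_imset.
- by move: (key v); rewrite tDw tCw eqxx.
apply/negP=> /imsetP[v _ ey]; move: (key v).
by rewrite tDw tCw ey eqxx.
Qed.

Lemma emb_finals T : finals (fN @: T) = fN @: finals T.
Proof.
apply/setP=> y; apply/idP/imsetP => [|[v]]; rewrite inE => /existsP[w /andP[xw /eqP sw]].
  have /imsetP[v vT ev] : src C w \in fN @: T by case/andP: xw.
  have [w' ew] := emb_surjW E ev; subst w; exists v; last by rewrite -sw.
  rewrite inE; apply/existsP; exists w'; rewrite -emb_exitS xw /=.
  by rewrite -(inj_eq injN) -(emb_src E) ev.
by move=> ->; rewrite inE; apply/existsP; exists (fW w); rewrite emb_exitS xw (emb_src E) sw eqxx.
Qed.

Lemma emb_setD (T X : {set node D}) : fN @: T :\: fN @: X = fN @: (T :\: X).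
Proof.
apply/setP=> y; apply/setDP/imsetP => [[/imsetP[v vT ->]]|[v]].
  by rewrite mem_imset // => vX; exists v; rewrite ?inE ?vT ?vX.
by rewrite inE => /andP[vX vT] ->; rewrite !mem_imset.
Qed.

Lemma emb_setD1 T v : fN @: T :\ fN v = fN @: (T :\ v).
Proof. by rewrite -emb_setD imset_set1. Qed.

Lemma imset_imset_inj : injective (fun X : {set node D} => fN @: X).
Proof. exact: imset_inj. Qed.

(** Readiness depends only on kinds, final nodes, components, and sources and targets of wires, all
    of which are compatible with direct images. Injectivity preserves the number and the
    distinctness of components. *)
Lemma emb_ready T N R : ready_res T N R ->
  ready_res (fN @: T) (fN N) ((fun X : {set node D} => fN @: X) @: R).
Proof.
case=> NT; rewrite /ready_res emb_finals mem_imset // (emb_kind E) => rdy; split=> //.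
case: (kind D N) rdy => [|//|[]|].
- by case=> -> ->; rewrite imset_set1 imset0.
- by case=> c2 ->; rewrite emb_setD1 emb_comps card_imset //; apply: imset_imset_inj.
- by case=> c2 ->; rewrite emb_setD1 emb_comps card_imset //; apply: imset_imset_inj.
- case=> fin [X1 [X2 [nX [cX [wX ->]]]]]; split.
    move=> _ /imsetP[M MT ->] MN; rewrite (emb_kind E) fin //.
    by apply: contraNneq MN => ->.
  exists (fN @: X1), (fN @: X2); split; first by rewrite (inj_eq imset_imset_inj).
  split; first by rewrite emb_setD emb_comps cX imsetU !imset_set1.
  split; last by rewrite imsetU !imset_set1.
  move=> _ /imsetP[M MT ->]; have [w1 [w2 [t1 [t2 [s1 s2]]]]] := wX M MT.
  exists (fW w1), (fW w2); rewrite !(emb_src E) !mem_imset //.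
  by do !split=> //; apply/eqP; rewrite (emb_tgt E); apply/eqP.
- by move=> ->; rewrite emb_setD1 emb_comps.
Qed.

Lemma emb_erases T : erases T -> erases (fN @: T).
Proof.
elim=> {}T N R rdy _ IH; apply: (Erases (emb_ready rdy)) => _ /imsetP[Y YR ->].
exact: IH.
Qed.

Lemma emb_conn T : conn T -> conn (fN @: T).
Proof.
case=> nT cT; split; first by rewrite imset_eq0.
by move=> _ _ /imsetP[u uT ->] /imsetP[v vT ->]; apply/emb_connect/cT.
Qed.

End Transport.

(** * Translations of proofs are erasable *)

Lemma index_ex (T : eqType) (s : seq T) k : uniq s -> k < size s ->
  exists2 x, x \in s & index x s = k.
Proof.
case: s => // x0 s us ks; exists (nth x0 (x0 :: s) k); first exact: mem_nth.
exact: index_uniq.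
Qed.

Lemma mem_take_index (T : eqType) (s : seq T) k x :
  (x \in take k s) = (x \in s) && (index x s < k).
Proof.
have [xs|xs] := boolP (x \in s); first by rewrite in_take.
by apply: contraNF xs; apply: mem_take.
Qed.

Lemma pmap_onth_iota T (s : seq T) : pmap (onth s) (iota 0 (size s)) = s.
Proof.
elim: s => //= x s IHs; congr (_ :: _); rewrite -[in RHS]IHs -add1n iotaDl.
(* By conversion, [onth (x :: s)] at a successor is [onth s]. *)
by rewrite -[LHS]/(pmap _ (map S _)); elim: (iota _ _) => //= k l ->.
Qed.

Lemma perm_pmap_onth (T : eqType) (s : seq T) p :
  perm_eq p (iota 0 (size s)) -> perm_eq (pmap (onth s) p) s.
Proof. by move=> /(perm_pmap (onth s)); rewrite pmap_onth_iota. Qed.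

Section Built.
Variable L : Type.
Implicit Types C : circuit L.

(** The invariant of translations, [n] being the length of the conclusion. The facts on [exits]
    matter because the constructions find the wires to connect by their index there; [coh_conn]
    ensures that deleting the last node or layer leaves each premise as one component. *)
Record coherent n C : Prop := Coherent {
  coh_uniq : uniq (exits C);
  coh_size : size (exits C) = n;
  coh_mem : forall w, (w \in exits C) = (tgt C w == None);
  coh_conn : conn [set: node C];
  coh_erases : erases [set: node C]
}.

(** A wire outside [exits] has index [size (exits C)], so it is never mistaken for a position below
    [n]. *)
Lemma coh_index n C w k : coherent n C -> k < n -> index w (exits C) = k -> tgt C w = None.
Proof. by move=> coh kn iw; apply/eqP; rewrite -(coh_mem coh) -index_mem iw (coh_size coh). Qed.

Lemma coh_ge n C w : coherent n C -> (n <= index w (exits C)) = (tgt C w != None).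
Proof. by move=> coh; rewrite -(coh_mem coh) -index_mem (coh_size coh) -leqNgt. Qed.

Lemma coh_wire n C k : coherent n C -> k < n -> exists w, index w (exits C) = k.
Proof.
move=> coh; rewrite -(coh_size coh) => /(index_ex (coh_uniq coh))[w _ iw].
by exists w.
Qed.

Lemma coh_ax (dual : L -> L) a : coherent 2 (ax_circ dual a).
Proof.
have T1 : [set: unit] = [set tt] by apply/setP=> -[]; rewrite !inE.
split=> //; first by case.
  by rewrite /= T1; apply: (conn1 (C := ax_circ dual a)).
rewrite /= T1; apply: (@Erases _ (ax_circ dual a) _ tt set0); last by move=> Y; rewrite inE.
by split=> //; rewrite inE; apply/existsP; exists true; rewrite /exitS inE.
Qed.

Lemma coh_perm n C p : perm_eq p (iota 0 n) -> coherent n C -> coherent n (perm_circ p C).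
Proof.
move=> pp coh; have := @perm_pmap_onth _ (exits C) p; rewrite (coh_size coh) => /(_ pp) pe.
have E : @embedding _ C (perm_circ p C) id id by split=> //= w v; exists w.
split=> /=.
- by rewrite (perm_uniq pe) (coh_uniq coh).
- by rewrite (perm_size pe) (coh_size coh).
- by move=> w; rewrite (perm_mem pe) (coh_mem coh).
- by have := emb_conn E (coh_conn coh); rewrite imset_id.
- by have := emb_erases E (coh_erases coh); rewrite imset_id.
Qed.

(** * The par and plus rules *)

Lemma setT_Some (T : finType) : [set: option T] = None |: Some @: [set: T].
Proof. by apply/setP=> -[x|]; rewrite !inE // mem_imset ?inE //; apply: Some_inj. Qed.

Lemma None_Some (T : finType) (A : {set T}) : None \notin Some @: A.
Proof. by apply/negP=> /imsetP[]. Qed.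

Lemma setT_None (T : finType) : [set: option T] :\ None = Some @: [set: T].
Proof. by rewrite setT_Some setU1K ?None_Some. Qed.

Lemma uniq_rcons_None (T : eqType) (s : seq T) : uniq s -> uniq (rcons (map Some s) None).
Proof.
move=> us; rewrite rcons_uniq map_inj_uniq ?us ?andbT; last exact: Some_inj.
by apply/mapP=> -[].
Qed.

(** Only exits are redirected, and they go to the new node [None], outside the image; all other
    targets are unchanged. *)
Lemma emb_par n A B C : coherent n.+2 C -> @embedding _ C (par_circ n A B C) Some Some.
Proof.
move=> coh; split=> //=; try exact: Some_inj.
  by move=> [w|] v //= _; exists w.
move=> w v; case: ifP => [|_]; last by case: (tgt C w).
by case/orP=> /eqP /(coh_index coh) ->.
Qed.

Lemma coh_par n A B C : coherent n.+2 C -> coherent n.+1 (par_circ n A B C).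
Proof.
move=> coh; have E := emb_par A B coh; set C' := par_circ n A B C in E *.
have cS := emb_conn E (coh_conn coh).
have [w iw] := coh_wire coh (leqnSn n.+1).
split=> /=.
- exact/uniq_rcons_None/take_uniq/(coh_uniq coh).
- by rewrite size_rcons size_map size_takel // (coh_size coh) !leqW.
- case=> [x|]; rewrite mem_rcons inE ?eqxx //=.
  rewrite mem_map; last exact: Some_inj.
  rewrite mem_take_index (coh_mem coh).
  case: ifP => [|/norP[]]; first by case/orP=> /eqP ->; rewrite ?ltnn ?ltnNge ?leqnSn andbF.
  (* Among [n.+2] exits, those other than the last two are the ones of index below [n]. *)
  have := coh_ge x coh; case: (tgt C x) => [v|] //= /negbT.
  by rewrite -ltnNge ltnS leq_eqVlt ltnS leq_eqVlt => /or3P[->|->|->].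
- rewrite setT_Some; apply: (@connU _ C' _ _ None (Some (src C w)) (conn1 _) cS).
  + by rewrite inE.
  + by rewrite mem_imset ?inE //; apply: Some_inj.
  + by rewrite adj_sym; apply: (@wire_adj _ C' (Some w)); rewrite /= iw eqxx.
(* Deleting the new node leaves the copy of [C], a single component by connectedness, so the node is
   ready. *)
- apply: (@Erases _ C' _ None [set Some @: setT]).
    split; first by rewrite inE; apply/existsP; exists None; rewrite /exitS inE.
    by rewrite /= setT_None comps1 // cards1.
  by move=> Y; rewrite inE => /eqP->; apply: emb_erases E _ (coh_erases coh).
Qed.

Lemma emb_plus n A0 A1 b C : coherent n.+1 C -> @embedding _ C (plus_circ n A0 A1 b C) Some Some.
Proof.
move=> coh; split=> //=; try exact: Some_inj.
  by move=> [w|] v //= _; exists w.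
move=> w v; case: ifP => [|_]; last by case: (tgt C w).
by move/eqP=> /(coh_index coh) ->.
Qed.

Lemma coh_plus n A0 A1 b C : coherent n.+1 C -> coherent n.+1 (plus_circ n A0 A1 b C).
Proof.
move=> coh; have E := emb_plus A0 A1 b coh; set C' := plus_circ n A0 A1 b C in E *.
have cS := emb_conn E (coh_conn coh).
have [w iw] := coh_wire coh (ltnSn n).
split=> /=.
- exact/uniq_rcons_None/take_uniq/(coh_uniq coh).
- by rewrite size_rcons size_map size_takel // (coh_size coh) leqW.
- case=> [x|]; rewrite mem_rcons inE ?eqxx //=.
  rewrite mem_map; last exact: Some_inj.
  rewrite mem_take_index (coh_mem coh).
  case: (index _ _ =P n) => [->|/eqP]; first by rewrite ltnn andbF.
  have := coh_ge x coh; case: (tgt C x) => [v|] //= /negbT.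
  by rewrite -ltnNge ltnS leq_eqVlt => /orP[->|->].
- rewrite setT_Some; apply: (@connU _ C' _ _ None (Some (src C w)) (conn1 _) cS).
  + by rewrite inE.
  + by rewrite mem_imset ?inE //; apply: Some_inj.
  + by rewrite adj_sym; apply: (@wire_adj _ C' (Some w)); rewrite /= iw eqxx.
- apply: (@Erases _ C' _ None [set Some @: setT]).
    split; first by rewrite inE; apply/existsP; exists None; rewrite /exitS inE.
    by rewrite /= setT_None comps1.
  by move=> Y; rewrite inE => /eqP->; apply: emb_erases E _ (coh_erases coh).
Qed.

(** * The tensor rule *)

Lemma setT_sum (T1 T2 : finType) (T : finType) (f : T1 + T2 -> T) :
  f @: [set: T1 + T2] = (fun x => f (inl x)) @: [set: T1] :|: (fun x => f (inr x)) @: [set: T2].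
Proof.
apply/setP=> y; apply/imsetP/setUP => [[[x|x] _ ->]|[|] /imsetP[x _ ->]].
- by left; apply/imsetP; exists x.
- by right; apply/imsetP; exists x.
- by exists (inl x).
- by exists (inr x).
Qed.

Section Tensor.
Variables (n m : nat) (A B : formula L) (C1 C2 : circuit L).
Hypotheses (coh1 : coherent n.+1 C1) (coh2 : coherent m.+1 C2).
Let C' := tens_circ n A B C1 C2.
Let f1 (v : node C1) : node C' := Some (inl v).
Let g1 (w : wire C1) : wire C' := Some (inl w).
Let f2 (v : node C2) : node C' := Some (inr v).
Let g2 (w : wire C2) : wire C' := Some (inr w).

Lemma emb_tensl : embedding f1 g1.
Proof.
split=> //= [x y []|x y []|[[w|w]|] v //= _|w v] //; first by exists w.
case: ifP => [|_]; last by case: (tgt C1 w).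
by move/eqP=> /(coh_index coh1) ->.
Qed.

Lemma emb_tensr : embedding f2 g2.
Proof.
split=> //= [x y []|x y []|[[w|w]|] v //= _|w v] //; first by exists w.
case: ifP => [|_]; last by case: (tgt C2 w).
by move/eqP=> /(coh_index coh2) ->.
Qed.

Lemma coh_tens : coherent (n + m.+1) C'.
Proof.
have c1 := emb_conn emb_tensl (coh_conn coh1).
have c2 := emb_conn emb_tensr (coh_conn coh2).
have [w1 i1] := coh_wire coh1 (ltnSn n).
have [w2 i2] := coh_wire coh2 (ltn0Sn m).
have TT : [set: node C'] = None |: (f1 @: setT :|: f2 @: setT).
  by rewrite /= setT_Some setT_sum.
have NT : [set: node C'] :\ None = f1 @: setT :|: f2 @: setT.
  by rewrite /= setT_None setT_sum.
(* No wire joins the two copies directly, so without the new node they are separate components. *)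
have nadj u v : u \in f1 @: setT -> v \in f2 @: setT -> ~~ adj u v.
  move=> /imsetP[x _ ->] /imsetP[y _ ->]; apply/existsP=> -[[[w|w]|] /orP[] /andP[/eqP // _ /eqP]] //=.
    by case: ifP => // _; case: (tgt C1 w).
  by case: ifP => // _; case: (tgt C2 w).
have cps : comps (f1 @: setT :|: f2 @: setT) = [set f1 @: setT; f2 @: setT] by apply: comps2.
split=> /=.
- rewrite cat_uniq /= !map_inj_uniq; try by move=> x y [].
  rewrite take_uniq ?(coh_uniq coh1) //=.
  case: (exits C2) (coh_size coh2) (coh_uniq coh2) => //= x s _ /andP[_ ->].
  rewrite !andbT; apply/andP; split; last by apply/mapP=> -[].
  rewrite negb_or; apply/andP; split; first by apply/mapP=> -[].
  by apply/hasP=> -[_ /mapP[y _ ->] /mapP[]].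
- rewrite size_cat /= !size_map size_behead size_takel ?(coh_size coh1) //.
  by rewrite (coh_size coh2).
- case=> [[x|x]|]; rewrite mem_cat inE /=.
  + rewrite mem_map; last by move=> ? ? [].
    have -> : (Some (inl x) \in [seq Some (inr w) | w <- behead (exits C2)]) = false.
      by apply/mapP=> -[].
    rewrite orbF mem_take_index (coh_mem coh1).
    case: (index _ _ =P n) => [->|/eqP]; first by rewrite ltnn andbF.
    have := coh_ge x coh1; case: (tgt C1 x) => [v|] //= /negbT.
    by rewrite -ltnNge ltnS leq_eqVlt => /orP[->|->].
  + rewrite mem_map; last by move=> ? ? [].
    have -> : (Some (inr x) \in [seq Some (inl w) | w <- take n (exits C1)]) = false.
      by apply/mapP=> -[].
    have := coh_mem coh2 x; have := coh_uniq coh2.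
    case: (exits C2) (coh_size coh2) => //= y s _ /andP[ys _]; rewrite inE [x == y]eq_sym.
    (* The first exit is consumed by the new node; as [exits] is duplicate-free, it does not
       reappear in the tail. *)
    case: eqP => [<-|_] /= xs; first by rewrite (negPf ys).
    by rewrite xs; case: (tgt C2 x).
  + by rewrite eqxx orbT.
- have c0 := conn1 (C := C') None.
  have cl : @conn _ C' (None |: f1 @: setT).
    apply: (connU (C := C') (u := None) (v := f1 (src C1 w1)) c0 c1); rewrite ?inE ?imset_f ?inE //.
    by rewrite adj_sym; apply: (@wire_adj _ C' (g1 w1)); rewrite /= i1 eqxx.
  rewrite TT setUA; apply: (connU (C := C') (u := None) (v := f2 (src C2 w2)) cl c2); rewrite ?inE ?imset_f ?inE //.
  by rewrite adj_sym; apply: (@wire_adj _ C' (g2 w2)); rewrite /= i2 eqxx.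
- apply: (@Erases _ C' _ None [set f1 @: setT; f2 @: setT]).
    split; first by rewrite inE; apply/existsP; exists None; rewrite /exitS inE.
    (* The copies differ because they share no node, which gives the count of two that the tensor
       case demands. *)
    rewrite /= [_ :\ _]NT cps cards2; split=> //; case: eqP => // eq12.
    have : f1 (src C1 w1) \in f2 @: setT by rewrite -eq12 imset_f ?inE.
    by case/imsetP.
  move=> Y; rewrite !inE => /orP[] /eqP->.
    exact: emb_erases emb_tensl _ (coh_erases coh1).
  exact: emb_erases emb_tensr _ (coh_erases coh2).
Qed.

End Tensor.

(** * The with rule *)

Section With.
Variables (G : seq (formula L)) (A0 A1 : formula L) (C1 C2 : circuit L).
Let n := size G.
Hypotheses (coh1 : coherent n.+1 C1) (coh2 : coherent n.+1 C2).
Let C' := with_circ G A0 A1 C1 C2.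
Let f1 (v : node C1) : node C' := Some (inl (inl v)).
Let g1 (w : wire C1) : wire C' := inl (inl w).
Let f2 (v : node C2) : node C' := Some (inl (inr v)).
Let g2 (w : wire C2) : wire C' := inl (inr w).
Let X1 : {set node C'} := f1 @: setT.
Let X2 : {set node C'} := f2 @: setT.
Let contr (j : 'I_n) : node C' := Some (inr j).

Lemma emb_withl : embedding f1 g1.
Proof.
split=> //= [x y []|x y []|[[w|w]|[j|]] v //= _|w v] //; first by exists w.
case: ifP => [/eqP/(coh_index coh1)-> //|_].
case: insubP => [j jn _|_]; last by case: (tgt C1 w).
by rewrite (coh_index coh1 (ltnW jn) erefl).
Qed.

Lemma emb_withr : embedding f2 g2.
Proof.
split=> //= [x y []|x y []|[[w|w]|[j|]] v //= _|w v] //; first by exists w.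
case: ifP => [/eqP/(coh_index coh2)-> //|_].
case: insubP => [j jn _|_]; last by case: (tgt C2 w).
by rewrite (coh_index coh2 (ltnW jn) erefl).
Qed.

(** Index [n] is redirected to the & node and a smaller index to a contraction node; a larger index
    belongs to a wire that had a target already. So the premises keep no exit. *)
Lemma with_tgtl w : tgt C' (g1 w) != None.
Proof.
rewrite /=; case: (index _ _ =P _) => [//|/eqP nn].
case: insubP => [//|]; rewrite -leqNgt => le.
have : n < index w (exits C1) by rewrite ltn_neqAle eq_sym nn.
by rewrite (coh_ge w coh1); case: (tgt C1 w).
Qed.

Lemma with_tgtr w : tgt C' (g2 w) != None.
Proof.
rewrite /=; case: (index _ _ =P _) => [//|/eqP nn].
case: insubP => [//|]; rewrite -leqNgt => le.
have : n < index w (exits C2) by rewrite ltn_neqAle eq_sym nn.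
by rewrite (coh_ge w coh2); case: (tgt C2 w).
Qed.

Lemma with_tgtN w : index w (exits C1) = n -> tgt C' (g1 w) = Some None.
Proof. by rewrite /= => ->; rewrite eqxx. Qed.

Lemma with_tgtNr w : index w (exits C2) = n -> tgt C' (g2 w) = Some None.
Proof. by rewrite /= => ->; rewrite eqxx. Qed.

Lemma with_tgtC (j : 'I_n) w : index w (exits C1) = j -> tgt C' (g1 w) = Some (contr j).
Proof. by rewrite /= => ->; rewrite (ltn_eqF (ltn_ord j)) valK. Qed.

Lemma with_tgtCr (j : 'I_n) w : index w (exits C2) = j -> tgt C' (g2 w) = Some (contr j).
Proof. by rewrite /= => ->; rewrite (ltn_eqF (ltn_ord j)) valK. Qed.

(** Since no wire of a premise exits, the final nodes are precisely the added layer, whose deletion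
    leaves the two copies. *)
Lemma with_finals : finals [set: node C'] = ~: (X1 :|: X2).
Proof.
apply/setP=> v; rewrite !inE; apply/existsP/idP => [[w /andP[xw /eqP <-]]|].
  have {xw} tw : tgt C' w = None by move: xw; rewrite /exitS; case: (tgt C' w) => // y; rewrite !inE.
  case: w tw => [[w|w]|w] tw; first by have := with_tgtl w; rewrite tw.
    by have := with_tgtr w; rewrite tw.
  by apply/norP; split; apply/imsetP=> -[x _]; case: w {tw}.
case: v => [[[v|v]|j]|]; first by rewrite [_ \in X1]imset_f ?inE.
- by rewrite [_ \in X2]imset_f ?inE ?orbT.
- by exists (inr (Some j)); rewrite /exitS inE /= eqxx.
- by exists (inr None); rewrite /exitS inE.
Qed.

Lemma coh_with : coherent n.+1 C'.
Proof.
have c1 : conn X1 := emb_conn emb_withl (coh_conn coh1).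
have c2 : conn X2 := emb_conn emb_withr (coh_conn coh2).
have in1 x : f1 x \in X1 by rewrite imset_f ?inE.
have in2 x : f2 x \in X2 by rewrite imset_f ?inE.
have [w1 i1] := coh_wire coh1 (ltnSn n).
have [w2 i2] := coh_wire coh2 (ltnSn n).
have nadj u v : u \in X1 -> v \in X2 -> ~~ adj u v.
  move=> /imsetP[x _ ->] /imsetP[y _ ->].
  apply/existsP=> -[[[w|w]|[j|]] /orP[] /andP[/eqP // _ /eqP]] //=.
    by case: ifP => // _; case: insubP => [//|_]; case: (tgt C1 w).
  by case: ifP => // _; case: insubP => [//|_]; case: (tgt C2 w).
split.
- rewrite /= rcons_uniq map_inj_uniq ?enum_uniq ?andbT; last by move=> x y [].
  by apply/mapP=> -[].
- by rewrite /= size_rcons size_map size_enum_ord.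
- have nin (x : wire C1 + wire C2) : inl x \notin exits C'.
    by rewrite /= mem_rcons inE /=; apply/mapP=> -[].
  case=> [[x|x]|[j|]]; rewrite ?(negPf (nin _)).
  + by rewrite (negPf (with_tgtl x)).
  + by rewrite (negPf (with_tgtr x)).
  + by rewrite /= mem_rcons inE mem_map ?mem_enum // => ? ? [].
  + by rewrite /= mem_rcons inE eqxx.
- have c0 := conn1 (C := C') None.
  have cl : @conn _ C' (None |: X1).
    apply: (connU (C := C') (u := None) (v := f1 (src C1 w1)) c0 c1); rewrite ?inE //.
    by rewrite adj_sym; apply: (@wire_adj _ C' (g1 w1)); apply: with_tgtN.
  have clr : @conn _ C' (None |: X1 :|: X2).
    apply: (connU (C := C') (u := None) (v := f2 (src C2 w2)) cl c2); rewrite ?inE //.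
    by rewrite adj_sym; apply: (@wire_adj _ C' (g2 w2)); apply: with_tgtNr.
  (* The contraction nodes form the fringe: the [j]-th one receives the [j]-th exit of the first
     premise. *)
  apply: (conn_fringe clr) => [|x _]; first exact: subsetT.
  case: x => [[[v|v]|j]|]; rewrite !in_setU ?in1 ?in2 ?orbT // ?in_set1 //.
  move=> _; have [w iw] := @coh_wire _ _ j coh1 (ltnW (ltn_ord j)).
  exists (f1 (src C1 w)); first by rewrite !in_setU in1 orbT.
  by rewrite adj_sym; apply: (@wire_adj _ C' (g1 w)); apply: with_tgtC.
- apply: (@Erases _ C' _ None [set X1; X2]); last first.
    move=> Y; rewrite !inE => /orP[] /eqP->.
      exact: emb_erases emb_withl _ (coh_erases coh1).
    exact: emb_erases emb_withr _ (coh_erases coh2).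
  have NX : None \in finals [set: node C'].
    by rewrite with_finals !inE; apply/norP; split; apply/imsetP=> -[].
  split=> //=; split.
    rewrite with_finals; case=> [[[v|v]|j]|] //.
      by rewrite !inE [_ \in X1]in1.
    by rewrite !inE [_ \in X2]in2 orbT.
  exists X1, X2; split.
    apply/eqP=> eqX; have := in1 (src C1 w1); rewrite eqX.
    by case/imsetP.
  split; first by rewrite with_finals setTD setCK; exact: (comps2 c1 c2 nadj).
  split=> // M; rewrite with_finals; case: M => [[[v|v]|j]|] MX.
  + by rewrite !inE [_ \in X1]in1 in MX.
  + by rewrite !inE [_ \in X2]in2 orbT in MX.
  + have [u1 k1] := @coh_wire _ _ j coh1 (ltnW (ltn_ord j)).
    have [u2 k2] := @coh_wire _ _ j coh2 (ltnW (ltn_ord j)).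
    exists (g1 u1), (g2 u2); split; first exact: with_tgtC.
    by split; [exact: with_tgtCr | split; [exact: in1 | exact: in2]].
  + exists (g1 w1), (g2 w2); split; first exact: with_tgtN.
    by split; [exact: with_tgtNr | split; [exact: in1 | exact: in2]].
Qed.

End With.

Lemma coh_translate (dual : L -> L) G (pi : proof dual G) : coherent (size G) (translate pi).
Proof.
elim: pi => {G}.
- exact: coh_ax.
- move=> G p pp pi IH; have szp : size (pmap (onth G) p) = size G.
    by rewrite size_pmap (permP pp) -size_pmap pmap_onth_iota.
  by rewrite szp; apply: coh_perm.
- move=> G A B pi; rewrite !size_cat /= addn1 addn2; exact: coh_par.
- move=> G A0 A1 i pi; rewrite !size_cat /= addn1; exact: coh_plus.
- move=> G D A B pi1 IH1 pi2 IH2; rewrite size_cat /=; apply: coh_tens => //.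
  by move: IH1; rewrite size_cat addn1.
- move=> G A0 A1 pi1 + pi2; rewrite !size_cat /= addn1; exact: coh_with.
Qed.

(** An isomorphism is a surjective embedding, so it carries the whole node set to the whole node
    set. *)
Lemma circ_iso_erases (C1 C2 : circuit L) : circ_iso C1 C2 ->
  erases [set: node C1] -> erases [set: node C2].
Proof.
case=> fN [fW [bN [bW [ek [_ [es [et _]]]]]]].
have E : embedding fN fW.
  split=> // [||w v _|w v]; try exact: bij_inj.
    by case: bW => g _ gK; exists (g w); rewrite gK.
  by rewrite et; case: (tgt C1 w) => //= x; rewrite !(inj_eq Some_inj) (inj_eq (bij_inj bN)).
move=> /(emb_erases E); suff -> : fN @: setT = setT by [].
by apply/setP=> y; rewrite inE; case: bN => g _ gK; rewrite -[y]gK imset_f ?inE.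
Qed.

End Built.

(** * Realizing subcircuits by translations *)

Section Realization.
Variables (L : Type) (C : circuit L).
Implicit Types (S X Y : {set node C}) (w q : wire C) (e : seq (wire C)).

(* [D] is isomorphic to the subcircuit of [C] on the nodes [S], with exit order [e]. *)
Record realizes (D : circuit L) S e
    (fN : node D -> node C) (fW : wire D -> wire C) : Prop := Realizes {
  rz_injN : injective fN;
  rz_injW : injective fW;
  rz_in : forall v, fN v \in S;
  rz_ontoN : forall v, v \in S -> exists u, v = fN u;
  rz_ontoW : forall w, src C w \in S -> exists x, w = fW x;
  rz_kind : forall v, kind C (fN v) = kind D v;
  rz_lab : forall x, lab C (fW x) = lab D x;
  rz_src : forall x, src C (fW x) = fN (src D x);
  rz_tgt : forall x v, tgt D x = Some v -> tgt C (fW x) = Some (fN v);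
  rz_exit : forall x, tgt D x = None -> exitS S (fW x);
  rz_left : forall x, designated x -> isleft C (fW x) = isleft D x;
  rz_exits : map fW (exits D) = e
}.

Definition enumerates e S := uniq e /\ forall w, (w \in e) = exitS S w.

Lemma enumerates_perm e e' S : perm_eq e e' -> enumerates e S -> enumerates e' S.
Proof.
by move=> pe [ue me]; split=> [|w]; rewrite -?(perm_uniq pe) // -(perm_mem pe).
Qed.

(** Translates the positions in [exits D], which steer the constructions on circuits, into positions
    in [e]. *)
Lemma rz_index D S e fN fW x : @realizes D S e fN fW -> index x (exits D) = index (fW x) e.
Proof. by move=> rz; rewrite -(rz_exits rz) index_map //; apply: (rz_injW rz). Qed.

Lemma rz_exit_mem D S e fN fW x : @realizes D S e fN fW -> enumerates e S ->
  tgt D x = None -> fW x \in e.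
Proof. by move=> rz [_ ->]; apply: (rz_exit rz). Qed.

Lemma index_nth_eq (e : seq (wire C)) w0 w k : k < size e -> index w e = k -> w = nth w0 e k.
Proof. by move=> ke iw; rewrite -iw nth_index // -index_mem iw. Qed.

Lemma outs_src N o : outs N = [set o] -> src C o = N.
Proof. by move=> oN; have := set11 o; rewrite -oN inE => /eqP. Qed.

Lemma outs_eq N o w : outs N = [set o] -> src C w = N -> w = o.
Proof. by move=> oN sw; apply/set1P; rewrite -oN inE sw. Qed.

Lemma index_rcons_last (T : eqType) (s : seq T) x :
  x \notin s -> index x (rcons s x) = size s.
Proof. by move=> xs; rewrite -cats1 index_cat (negPf xs) /= eqxx addn0. Qed.

(** The new node and the new wire, both [None], are sent to [N] and [o]. The wire at position
    [size e0] is [w0], the only one whose target and designation are reset. *)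
Lemma realizes_plus D S e0 w0 N o A0 A1 b fN fW :
    @realizes D S (rcons e0 w0) fN fW -> enumerates (rcons e0 w0) S ->
    N \notin S -> kind C N = NPlus -> outs N = [set o] -> tgt C w0 = Some N ->
    lab C o = Plus A0 A1 -> isleft C w0 = ~~ b ->
    {in rcons e0 o, forall w, exitS (N |: S) w} ->
  realizes (D := plus_circ (size e0) A0 A1 b D) (N |: S) (rcons e0 o) (oapp fN N) (oapp fW o).
Proof.
move=> rz en NS kN oN t0 lo l0 ex.
have so := outs_src oN.
have srcS x : src C (fW x) \in S by rewrite (rz_src rz) (rz_in rz).
have idx x : index x (exits D) = index (fW x) (rcons e0 w0) by apply: rz_index rz.
have last_idx x : index (fW x) (rcons e0 w0) = size e0 -> fW x = w0.
  by move=> /(@index_nth_eq _ w0) ->; rewrite ?size_rcons // nth_rcons ltnn eqxx.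
split=> /=.
- move=> [u|] [v|] //= => [/(rz_injN rz)->//|uN|uN]; case/negP: NS.
    by rewrite -uN (rz_in rz).
  by rewrite uN (rz_in rz).
- move=> [x|] [y|] //= => [/(rz_injW rz)->//|xo|xo]; case/negP: NS.
    by rewrite -so -xo.
  by rewrite -so xo.
- by case=> [v|] /=; rewrite !inE ?eqxx ?(rz_in rz) ?orbT.
- move=> v; rewrite !inE => /orP[/eqP->|/(rz_ontoN rz)[u ->]]; first by exists None.
  by exists (Some u).
- move=> w; rewrite !inE => /orP[/eqP/(outs_eq oN)->|/(rz_ontoW rz)[x ->]]; first by exists None.
  by exists (Some x).
- by case=> [v|] //=; rewrite (rz_kind rz).
- by case=> [x|] //=; rewrite (rz_lab rz).
- by case=> [x|] //=; rewrite (rz_src rz).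
- case=> [x|] v //=; rewrite idx; case: ifP => [/eqP/last_idx-> [<-] //|_].
  by case tx : (tgt D x) => [u|] //= [<-] /=; rewrite (rz_tgt rz tx).
- case=> [x|] /=; last by move=> _; apply: ex; rewrite mem_rcons inE eqxx.
  rewrite idx; case: eqP => // nx; case tx : (tgt D x) => [u|] //= _.
  (* An exit of [D] other than the redirected one lies in [e0], hence it still exits after [N] is
     added. *)
  have := rz_exit_mem rz en tx; rewrite mem_rcons inE => /orP[/eqP xw|xe].
    case: nx; rewrite xw index_rcons_last //.
    by case: en; rewrite rcons_uniq => /andP[].
  by apply: ex; rewrite mem_rcons inE xe orbT.
- case=> [x|] //; rewrite /designated /= idx.
  case: ifP => [/eqP/last_idx-> //|_].
  by have := rz_left rz (x := x); rewrite /designated; case: (tgt D x) => [u|].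
- rewrite map_rcons -map_comp /=; congr rcons.
  rewrite -[LHS]/(map fW _) map_take (rz_exits rz).
  by rewrite -cats1 take_size_cat.
Qed.

Lemma realizes_par D S e0 wl wr N o A B fN fW :
    @realizes D S (e0 ++ [:: wl; wr]) fN fW -> enumerates (e0 ++ [:: wl; wr]) S ->
    N \notin S -> kind C N = NBin BPar -> outs N = [set o] ->
    tgt C wl = Some N -> tgt C wr = Some N ->
    lab C o = Par A B -> isleft C wl -> ~~ isleft C wr ->
    {in rcons e0 o, forall w, exitS (N |: S) w} ->
  realizes (D := par_circ (size e0) A B D) (N |: S) (rcons e0 o) (oapp fN N) (oapp fW o).
Proof.
move=> rz en NS kN oN tl tr lo ll lr ex.
have so := outs_src oN.
have srcS x : src C (fW x) \in S by rewrite (rz_src rz) (rz_in rz).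
have idx x : index x (exits D) = index (fW x) (e0 ++ [:: wl; wr]) by apply: rz_index rz.
have idl x : index (fW x) (e0 ++ [:: wl; wr]) = size e0 -> fW x = wl.
  move=> /(@index_nth_eq _ wl) ->; first by rewrite nth_cat ltnn subnn.
  by rewrite size_cat addn2.
have idr x : index (fW x) (e0 ++ [:: wl; wr]) = (size e0).+1 -> fW x = wr.
  move=> /(@index_nth_eq _ wl) ->; first by rewrite nth_cat ltnNge leqnSn /= subSnn.
  by rewrite size_cat addn2.
split=> /=.
- move=> [u|] [v|] //= => [/(rz_injN rz)->//|uN|uN]; case/negP: NS.
    by rewrite -uN (rz_in rz).
  by rewrite uN (rz_in rz).
- move=> [x|] [y|] //= => [/(rz_injW rz)->//|xo|xo]; case/negP: NS.
    by rewrite -so -xo.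
  by rewrite -so xo.
- by case=> [v|] /=; rewrite !inE ?eqxx ?(rz_in rz) ?orbT.
- move=> v; rewrite !inE => /orP[/eqP->|/(rz_ontoN rz)[u ->]]; first by exists None.
  by exists (Some u).
- move=> w; rewrite !inE => /orP[/eqP/(outs_eq oN)->|/(rz_ontoW rz)[x ->]]; first by exists None.
  by exists (Some x).
- by case=> [v|] //=; rewrite (rz_kind rz).
- by case=> [x|] //=; rewrite (rz_lab rz).
- by case=> [x|] //=; rewrite (rz_src rz).
- case=> [x|] v //=; rewrite idx; case: ifP => [/orP[/eqP/idl|/eqP/idr] -> [<-] //|_].
  by case tx : (tgt D x) => [u|] //= [<-] /=; rewrite (rz_tgt rz tx).
- case=> [x|] /=; last by move=> _; apply: ex; rewrite mem_rcons inE eqxx.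
  rewrite idx; case: ifP => // /norP[nl nr]; case tx : (tgt D x) => [u|] //= _.
  (* Excluding the last two positions leaves an index below [size e0], that is, a wire of [e0]. *)
  have := rz_exit_mem rz en tx; rewrite -index_mem size_cat addn2 !ltnS leq_eqVlt (negPf nr) /=.
  rewrite ltnS leq_eqVlt (negPf nl) /= => lt; apply: ex; rewrite mem_rcons inE; apply/orP; right.
  by move: lt; rewrite index_cat; case: ifP => // _; rewrite ltnNge leq_addr.
- case=> [x|] //; rewrite /designated /= idx.
  case: eqP => [/idl-> //|_]; case: eqP => [/idr-> //|_] /=; first by move/negPf: lr.
  by have := rz_left rz (x := x); rewrite /designated; case: (tgt D x) => [u|].
- rewrite map_rcons -map_comp /=; congr rcons.
  rewrite -[LHS]/(map fW _) map_take (rz_exits rz).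
  by rewrite take_size_cat.
Qed.

Definition tens_map (T1 T2 T : Type) (f1 : T1 -> T) (f2 : T2 -> T) (t : T)
    (x : option (T1 + T2)) : T :=
  match x with Some (inl y) => f1 y | Some (inr y) => f2 y | None => t end.

(** Disjointness of [S1] and [S2] makes the glued maps injective. The wire [wl] stands last and [wr]
    first, since these are the positions that the tensor rule connects. *)
Lemma realizes_tens D1 D2 S1 S2 e1 e2 wl wr N o A B f1 g1 f2 g2 :
    @realizes D1 S1 (rcons e1 wl) f1 g1 -> enumerates (rcons e1 wl) S1 ->
    @realizes D2 S2 (wr :: e2) f2 g2 -> enumerates (wr :: e2) S2 ->
    (forall v, v \in S1 -> v \notin S2) ->
    N \notin S1 -> N \notin S2 -> kind C N = NBin BTens -> outs N = [set o] ->
    tgt C wl = Some N -> tgt C wr = Some N ->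
    lab C o = Tens A B -> isleft C wl -> ~~ isleft C wr ->
    {in e1 ++ o :: e2, forall w, exitS (N |: (S1 :|: S2)) w} ->
  realizes (D := tens_circ (size e1) A B D1 D2) (N |: (S1 :|: S2)) (e1 ++ o :: e2)
    (tens_map f1 f2 N) (tens_map g1 g2 o).
Proof.
move=> rz1 en1 rz2 en2 dis NS1 NS2 kN oN tl tr lo ll lr ex.
have so := outs_src oN.
have in1 v : f1 v \in S1 by apply: rz_in rz1 _.
have in2 v : f2 v \in S2 by apply: rz_in rz2 _.
have src1 x : src C (g1 x) \in S1 by rewrite (rz_src rz1).
have src2 x : src C (g2 x) \in S2 by rewrite (rz_src rz2).
have idx1 x : index x (exits D1) = index (g1 x) (rcons e1 wl) by apply: rz_index rz1.
have idx2 x : index x (exits D2) = index (g2 x) (wr :: e2) by apply: rz_index rz2.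
have idl x : index (g1 x) (rcons e1 wl) = size e1 -> g1 x = wl.
  by move=> /(@index_nth_eq _ wl) ->; rewrite ?size_rcons // nth_rcons ltnn eqxx.
have idr x : index (g2 x) (wr :: e2) = 0 -> g2 x = wr.
  by move=> /(@index_nth_eq _ wl) ->.
split=> /=.
- have n1 u : f1 u <> N by move=> uN; rewrite -uN in1 in NS1.
  have n2 u : f2 u <> N by move=> uN; rewrite -uN in2 in NS2.
  have n12 u v : f1 u <> f2 v by move=> uv; have := dis _ (in1 u); rewrite uv in2.
  case=> [[u|u]|] [[v|v]|] //= => [/(rz_injN rz1)->|/n12|/n1|/esym/n12|/(rz_injN rz2)->|/n2|/esym/n1|/esym/n2] //.
- have n1 u : g1 u <> o by move=> uN; rewrite -so -uN src1 in NS1.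
  have n2 u : g2 u <> o by move=> uN; rewrite -so -uN src2 in NS2.
  have n12 u v : g1 u <> g2 v by move=> uv; have := dis _ (src1 u); rewrite uv src2.
  case=> [[u|u]|] [[v|v]|] //= => [/(rz_injW rz1)->|/n12|/n1|/esym/n12|/(rz_injW rz2)->|/n2|/esym/n1|/esym/n2] //.
- by case=> [[v|v]|] /=; rewrite !inE ?eqxx ?in1 ?in2 ?orbT.
- move=> v; rewrite !inE => /or3P[/eqP->|/(rz_ontoN rz1)[u ->]|/(rz_ontoN rz2)[u ->]].
  + by exists None.
  + by exists (Some (inl u)).
  + by exists (Some (inr u)).
- move=> w; rewrite !inE => /or3P[/eqP/(outs_eq oN)->|/(rz_ontoW rz1)[u ->]|/(rz_ontoW rz2)[u ->]].
  + by exists None.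
  + by exists (Some (inl u)).
  + by exists (Some (inr u)).
- by case=> [[v|v]|] //=; rewrite ?(rz_kind rz1) ?(rz_kind rz2).
- by case=> [[x|x]|] //=; rewrite ?(rz_lab rz1) ?(rz_lab rz2).
- by case=> [[x|x]|] //=; rewrite ?(rz_src rz1) ?(rz_src rz2).
- case=> [[x|x]|] v //=.
  + rewrite idx1; case: ifP => [/eqP/idl-> [<-] //|_].
    by case tx : (tgt D1 x) => [u|] //= [<-] /=; rewrite (rz_tgt rz1 tx).
  + rewrite idx2; case: ifP => [/eqP/idr-> [<-] //|_].
    by case tx : (tgt D2 x) => [u|] //= [<-] /=; rewrite (rz_tgt rz2 tx).
- case=> [[x|x]|] /=; last by move=> _; apply: ex; rewrite mem_cat inE eqxx orbT.
  + rewrite idx1; case: eqP => // nx; case tx : (tgt D1 x) => [u|] //= _.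
    have := rz_exit_mem rz1 en1 tx; rewrite mem_rcons inE => /orP[/eqP xw|xe].
      case: nx; rewrite xw index_rcons_last //.
      by case: en1; rewrite rcons_uniq => /andP[].
    by apply: ex; rewrite mem_cat xe.
  + rewrite idx2; case: eqP => // nx; case tx : (tgt D2 x) => [u|] //= _.
    have := rz_exit_mem rz2 en2 tx; rewrite inE => /orP[/eqP xw|xe].
      by case: nx; rewrite xw /= eqxx.
    by apply: ex; rewrite mem_cat inE xe !orbT.
- case=> [[x|x]|] //; rewrite /designated /=.
  + rewrite idx1; case: ifP => [/eqP/idl-> //|_].
    by have := rz_left rz1 (x := x); rewrite /designated; case: (tgt D1 x) => [u|].
  + rewrite idx2; case: ifP => [/eqP/idr-> //|_]; first by move/negPf: lr.
    by have := rz_left rz2 (x := x); rewrite /designated; case: (tgt D2 x) => [u|].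
- rewrite map_cat -map_comp /= -map_comp; congr (_ ++ _ :: _).
    rewrite -[LHS]/(map g1 _) map_take (rz_exits rz1).
    by rewrite -cats1 take_size_cat.
  by rewrite -[LHS]/(map g2 _) -behead_map (rz_exits rz2).
Qed.

Definition with_nmap (T1 T2 T : Type) n (f1 : T1 -> T) (f2 : T2 -> T) (h : 'I_n -> T) (t : T)
    (x : option (T1 + T2 + 'I_n)) : T :=
  match x with
  | Some (inl (inl y)) => f1 y | Some (inl (inr y)) => f2 y
  | Some (inr j) => h j | None => t end.

Definition with_wmap (T1 T2 T : Type) n (f1 : T1 -> T) (f2 : T2 -> T) (h : 'I_n -> T) (t : T)
    (x : T1 + T2 + option 'I_n) : T :=
  match x with
  | inl (inl y) => f1 y | inl (inr y) => f2 y
  | inr (Some j) => h j | inr None => t end.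

(** The three cases match the branches of [with_circ]: a premise of the & node, a premise of a
    contraction node and, beyond the last position, a wire that is not an exit. *)
Lemma with_index (D : circuit L) S e0 w0 h o fN fW :
    @realizes D S (rcons (map h e0) w0) fN fW -> enumerates (rcons (map h e0) w0) S ->
  forall x, [\/ index x (exits D) = size e0 /\ fW x = w0,
                index x (exits D) < size e0 /\ fW x = h (nth o e0 (index x (exits D))) |
                size e0 < index x (exits D) /\ tgt D x <> None].
Proof.
move=> rz en x; have := rz_exit_mem rz en (x := x); rewrite (rz_index x rz).
rewrite -index_mem size_rcons size_map; set i := index _ _ => mx.
have ixe : i <= size e0 -> fW x = nth w0 (rcons (map h e0) w0) i.
  by move=> le; apply: index_nth_eq => //; rewrite size_rcons size_map.
have [lt|gt|eq] := ltngtP i (size e0).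
- constructor 2; split=> //; rewrite ixe ?(ltnW lt) //.
  by rewrite nth_rcons size_map lt (nth_map o).
- constructor 3; split=> // /mx; by rewrite ltnS leqNgt gt.
- by constructor 1; split=> //; rewrite ixe eq // nth_rcons size_map ltnn eqxx.
Qed.

(** Each [q] in [e0] is the exit of a contraction node, entered by [h1 q] from [S1] and by [h2 q]
    from [S2], so the common list [e0] aligns the exits of both premises. The [j]-th new contraction
    node goes to the source of the [j]-th wire of [e0]; [o] is only a default for [nth]. *)
Lemma realizes_with D1 D2 S S1 S2 e0 h1 h2 wl wr N o A0 A1 f1 g1 f2 g2 :
    @realizes D1 S1 (rcons (map h1 e0) wl) f1 g1 -> enumerates (rcons (map h1 e0) wl) S1 ->
    @realizes D2 S2 (rcons (map h2 e0) wr) f2 g2 -> enumerates (rcons (map h2 e0) wr) S2 ->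
    (forall v, v \in S1 -> v \notin S2) ->
    enumerates (rcons e0 o) S ->
    {in rcons e0 o, forall q, outs (src C q) = [set q]} ->
    {in e0, forall q, kind C (src C q) = NContr} ->
    src C o = N -> kind C N = NBin BWith ->
    (forall v, v \in S <-> [\/ v \in S1, v \in S2 | exists2 q, q \in rcons e0 o & v = src C q]) ->
    {in rcons e0 o, forall q, src C q \notin S1} ->
    {in rcons e0 o, forall q, src C q \notin S2} ->
    {in e0, forall q, tgt C (h1 q) = Some (src C q)} ->
    {in e0, forall q, tgt C (h2 q) = Some (src C q)} ->
    tgt C wl = Some N -> tgt C wr = Some N ->
    lab C o = With A0 A1 -> isleft C wl -> ~~ isleft C wr ->
  realizes (D := with_circ (map (lab C) e0) A0 A1 D1 D2) S (rcons e0 o)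
    (with_nmap f1 f2 (fun j => src C (nth o e0 j)) N)
    (with_wmap g1 g2 (fun j => nth o e0 j) o).
Proof.
move=> rz1 en1 rz2 en2 dis en so1 kc so kN memS nS1 nS2 t1 t2 tl tr lo ll lr.
have in1 v : f1 v \in S1 by apply: rz_in rz1 _.
have in2 v : f2 v \in S2 by apply: rz_in rz2 _.
have src1 x : src C (g1 x) \in S1 by rewrite (rz_src rz1).
have src2 x : src C (g2 x) \in S2 by rewrite (rz_src rz2).
have nin (j : 'I_(size (map (lab C) e0))) : nth o e0 j \in e0.
  by apply: mem_nth; rewrite -(size_map (lab C)) ltn_ord.
have ein q : q \in e0 -> q \in rcons e0 o by move=> qe; rewrite mem_rcons inE qe orbT.
have oin : o \in rcons e0 o by rewrite mem_rcons inE eqxx.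
have [ue me] := en; move: (ue); rewrite rcons_uniq => /andP[oe ue0].
have jlt (j : 'I_(size (map (lab C) e0))) : j < size e0.
  by rewrite -(size_map (lab C)) ltn_ord.
have nth_inj (i j : 'I_(size (map (lab C) e0))) : nth o e0 i = nth o e0 j -> i = j.
  by move=> /eqP eq; apply/val_inj/eqP; rewrite nth_uniq ?jlt in eq.
(* Each of these sources has a single outgoing wire, so [src C] is injective on the exits of [S]. *)
have src_inj q q' : q \in rcons e0 o -> q' \in rcons e0 o -> src C q = src C q' -> q = q'.
  by move=> qe _ eq; apply/esym; apply: (outs_eq (so1 _ qe)).
have ix1 := with_index o rz1 en1.
have ix2 := with_index o rz2 en2.
split=> /=.
- have n1 u q : q \in rcons e0 o -> f1 u <> src C q.
    by move=> qe uq; have := nS1 _ qe; rewrite -uq in1.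
  have n2 u q : q \in rcons e0 o -> f2 u <> src C q.
    by move=> qe uq; have := nS2 _ qe; rewrite -uq in2.
  have n12 u v : f1 u <> f2 v by move=> uv; have := dis _ (in1 u); rewrite uv in2.
  have nN (j : 'I_(size (map (lab C) e0))) : src C (nth o e0 j) <> src C o.
    by move=> /(src_inj _ _ (ein _ (nin j)) oin) eq; rewrite -eq nin in oe.
  have sj (i j : 'I_(size (map (lab C) e0))) : src C (nth o e0 i) = src C (nth o e0 j) -> i = j.
    by move=> /(src_inj _ _ (ein _ (nin i)) (ein _ (nin j)))/nth_inj.
  rewrite -so; case=> [[[u|u]|i]|] [[[v|v]|j]|] //= eq.
  + by rewrite (rz_injN rz1 eq).
  + by case: (n12 _ _ eq).
  + by case: (n1 _ _ (ein _ (nin j)) eq).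
  + by case: (n1 _ _ oin eq).
  + by case: (n12 _ _ (esym eq)).
  + by rewrite (rz_injN rz2 eq).
  + by case: (n2 _ _ (ein _ (nin j)) eq).
  + by case: (n2 _ _ oin eq).
  + by case: (n1 _ _ (ein _ (nin i)) (esym eq)).
  + by case: (n2 _ _ (ein _ (nin i)) (esym eq)).
  + by rewrite (sj _ _ eq).
  + by case: (nN _ eq).
  + by case: (n1 _ _ oin (esym eq)).
  + by case: (n2 _ _ oin (esym eq)).
  + by case: (nN _ (esym eq)).
- have n1 x q : q \in rcons e0 o -> g1 x <> q.
    by move=> qe xq; have := nS1 _ qe; rewrite -xq src1.
  have n2 x q : q \in rcons e0 o -> g2 x <> q.
    by move=> qe xq; have := nS2 _ qe; rewrite -xq src2.
  have n12 x y : g1 x <> g2 y by move=> xy; have := dis _ (src1 x); rewrite xy src2.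
  have nN (j : 'I_(size (map (lab C) e0))) : nth o e0 j <> o by move=> eq; have := nin j; rewrite eq (negPf oe).
  case=> [[x|x]|[i|]] [[y|y]|[j|]] //= eq.
  + by rewrite (rz_injW rz1 eq).
  + by case: (n12 _ _ eq).
  + by case: (n1 _ _ (ein _ (nin j)) eq).
  + by case: (n1 _ _ oin eq).
  + by case: (n12 _ _ (esym eq)).
  + by rewrite (rz_injW rz2 eq).
  + by case: (n2 _ _ (ein _ (nin j)) eq).
  + by case: (n2 _ _ oin eq).
  + by case: (n1 _ _ (ein _ (nin i)) (esym eq)).
  + by case: (n2 _ _ (ein _ (nin i)) (esym eq)).
  + by rewrite (nth_inj _ _ eq).
  + by case: (nN _ eq).
  + by case: (n1 _ _ oin (esym eq)).
  + by case: (n2 _ _ oin (esym eq)).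
  + by case: (nN _ (esym eq)).
- case=> [[[v|v]|j]|] /=; apply/memS; first by constructor 1.
  + by constructor 2.
  + by constructor 3; exists (nth o e0 j); rewrite ?ein.
  + by constructor 3; exists o.
- move=> v /memS[/(rz_ontoN rz1)[u ->]|/(rz_ontoN rz2)[u ->]|[q + ->]].
  + by exists (Some (inl (inl u))).
  + by exists (Some (inl (inr u))).
  rewrite mem_rcons inE => /orP[/eqP->|qe]; first by exists None.
  have qlt : index q e0 < size (map (lab C) e0) by rewrite size_map index_mem.
  by exists (Some (inr (Ordinal qlt))); rewrite /= nth_index.
- move=> w /memS[/(rz_ontoW rz1)[u ->]|/(rz_ontoW rz2)[u ->]|[q qe eq]].
  + by exists (inl (inl u)).
  + by exists (inl (inr u)).
  rewrite (outs_eq (so1 _ qe) eq).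
  move: qe; rewrite mem_rcons inE => /orP[/eqP->|qe]; first by exists (inr None).
  have qlt : index q e0 < size (map (lab C) e0) by rewrite size_map index_mem.
  by exists (inr (Some (Ordinal qlt))); rewrite /= nth_index.
- by case=> [[[v|v]|j]|] //=; rewrite ?(rz_kind rz1) ?(rz_kind rz2) ?kc.
- case=> [[x|x]|[j|]] //=; rewrite ?(rz_lab rz1) ?(rz_lab rz2) //.
  by rewrite (tnth_nth (lab C o)) /= (nth_map o) // -(size_map (lab C)).
- by case=> [[x|x]|[j|]] //=; rewrite ?(rz_src rz1) ?(rz_src rz2).
- case=> [[x|x]|[j|]] v //=.
  + case: (ix1 x) => -[]; rewrite -(size_map (lab C)).
    * by move=> -> ->; rewrite eqxx => -[<-].
    * move=> lt ->; rewrite (ltn_eqF lt) insubT => -[<-] /=.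
      by rewrite t1 // mem_nth // -(size_map (lab C)).
    * move=> gt nt; rewrite (gtn_eqF gt) insubF; last by rewrite ltnNge ltnW.
      by case tx : (tgt D1 x) => [u|] //= [<-] /=; rewrite (rz_tgt rz1 tx).
  + case: (ix2 x) => -[]; rewrite -(size_map (lab C)).
    * by move=> -> ->; rewrite eqxx => -[<-].
    * move=> lt ->; rewrite (ltn_eqF lt) insubT => -[<-] /=.
      by rewrite t2 // mem_nth // -(size_map (lab C)).
    * move=> gt nt; rewrite (gtn_eqF gt) insubF; last by rewrite ltnNge ltnW.
      by case tx : (tgt D2 x) => [u|] //= [<-] /=; rewrite (rz_tgt rz2 tx).
- case=> [[x|x]|[j|]] /=.
  + case: (ix1 x) => -[]; rewrite -(size_map (lab C)).
    * by move=> ->; rewrite eqxx.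
    * by move=> lt _; rewrite (ltn_eqF lt) insubT.
    * move=> gt; rewrite (gtn_eqF gt) insubF; last by rewrite ltnNge ltnW.
      by case: (tgt D1 x).
  + case: (ix2 x) => -[]; rewrite -(size_map (lab C)).
    * by move=> ->; rewrite eqxx.
    * by move=> lt _; rewrite (ltn_eqF lt) insubT.
    * move=> gt; rewrite (gtn_eqF gt) insubF; last by rewrite ltnNge ltnW.
      by case: (tgt D2 x).
  + by rewrite -me ein.
  + by rewrite -me.
- case=> [[x|x]|[j|]] //; rewrite /designated /=.
  + case: (ix1 x) => -[]; rewrite -(size_map (lab C)).
    * by move=> -> ->; rewrite eqxx.
    * by move=> lt _; rewrite (ltn_eqF lt) insubT.
    * move=> gt _; rewrite (gtn_eqF gt) insubF; last by rewrite ltnNge ltnW.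
      by have := rz_left rz1 (x := x); rewrite /designated; case: (tgt D1 x) => [u|].
  + case: (ix2 x) => -[]; rewrite -(size_map (lab C)).
    * by move=> -> ->; rewrite eqxx; move/negPf: lr.
    * by move=> lt _; rewrite (ltn_eqF lt) insubT.
    * move=> gt _; rewrite (gtn_eqF gt) insubF; last by rewrite ltnNge ltnW.
      by have := rz_left rz2 (x := x); rewrite /designated; case: (tgt D2 x) => [u|].
- rewrite map_rcons -map_comp /=; congr rcons.
  rewrite -[LHS]/(map (nth o e0 \o val) _) map_comp val_enum_ord size_map.
  by rewrite map_nth_iota0 // take_size.
Qed.

End Realization.

(** * Sequentialization *)

Lemma pmap_onth_map (T U : Type) (f : T -> U) s p :
  pmap (onth (map f s)) p = map f (pmap (onth s) p).
Proof.
elim: p => //= i p ->; have -> : onth (map f s) i = omap f (onth s i).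
  by elim: s i => [|x s IHs] [|i] //=.
by case: (onth s i).
Qed.

Lemma onth_index (T : eqType) (s : seq T) x : x \in s -> onth s (index x s) = Some x.
Proof.
by elim: s => //= y s IHs; rewrite inE eq_sym; case: eqP => [->|_] //= /IHs.
Qed.

(** Supplies the permutation that turns one enumeration of the exits into another. *)
Lemma pmap_onth_index (T : eqType) (s s' : seq T) : {subset s' <= s} ->
  pmap (onth s) (map (index^~ s) s') = s'.
Proof.
elim: s' => //= x s' IH sub; rewrite onth_index ?sub ?mem_head //= IH // => y ys.
by apply: sub; rewrite inE ys orbT.
Qed.

Lemma map_index_uniq (T : eqType) (s : seq T) : uniq s ->
  map (index^~ s) s = iota 0 (size s).
Proof.
case: s => // x0 s us; apply: (@eq_from_nth _ 0); rewrite size_map ?size_iota // => i lt.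
by rewrite (nth_map x0) // index_uniq // nth_iota.
Qed.

Section Sequentialization.
Variables (L : Type) (dual : L -> L) (C : circuit L).
Implicit Types (S X Y : {set node C}) (w q o : wire C) (e : seq (wire C)) (M N : node C).
Hypothesis loopless : forall w, tgt C w != Some (src C w).
Hypothesis wfC : forall v : node C, wf_node dual v.

(* The sequent is a separate parameter so that it can be rewritten: it is always
   the list of labels of [e]. *)
Definition sequentialized S e G :=
  exists (pi : proof dual G) fN fW, realizes (D := translate pi) S e fN fW.

(** The permutation rule changes nothing but the exit order, so the same maps realize both. Hence
    each rule may be treated for one convenient order. *)
Lemma sequentialized_reorder S e e' : enumerates e S -> enumerates e' S ->
  sequentialized S e (map (lab C) e) -> sequentialized S e' (map (lab C) e').
Proof.
move=> [ue me] [ue' me'] [pi [fN [fW rz]]].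
have ee' : perm_eq e' e by apply: uniq_perm => // w; rewrite me me'.
(* The argument of the permutation rule: where each wire of [e'] sits in [e]. *)
pose p := map (index^~ e) e'.
have pe : pmap (onth e) p = e' by apply: pmap_onth_index => w; rewrite (perm_mem ee').
have pp : perm_eq p (iota 0 (size (map (lab C) e))).
  by rewrite size_map -map_index_uniq //; apply: perm_map.
rewrite -{2}pe -pmap_onth_map; exists (pex pp pi), fN, fW.
case: rz => *; split=> //=.
by rewrite -pmap_onth_map; match goal with H : map fW _ = e |- _ => rewrite H end.
Qed.

(** Ensures that the wires entering a deleted node start in the set, and thus become exits of what
    remains. *)
Definition pclosed S := forall w v, tgt C w = Some v -> v \in S -> src C w \in S.

Lemma single_out v : kind C v <> NAx -> exists o, outs v = [set o].
Proof.
have := wfC v; rewrite /wf_node; case: (kind C v) => [//||t|].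
- by move=> [w1 [w2 [o [_ [_ [oo _]]]]]] _; exists o.
- by move=> [w1 [w2 [o [_ [_ [_ [oo _]]]]]]] _; exists o.
- by move=> [w1 [o [_ [_ [oo _]]]]] _; exists o.
Qed.

Lemma final_exit S N o : outs N = [set o] -> N \in finals S -> exitS S o.
Proof.
by move=> oN; rewrite inE => /existsP[w /andP[xw /eqP /(outs_eq oN)]] <-.
Qed.

Lemma finals_sub S N : N \in finals S -> N \in S.
Proof. by rewrite inE => /existsP[w /andP[/andP[sw _] /eqP <-]]. Qed.

Lemma exitS_tgt S w v : exitS S w -> tgt C w = Some v -> v \notin S.
Proof. by case/andP=> _ + tw; rewrite tw. Qed.

(** The only wire leaving a deleted node exits [S], so it cannot enter a node that remains. *)
Lemma pclosedD S (F : {set node C}) : pclosed S ->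
  {in F, forall M, exists2 o, outs M = [set o] & exitS S o} -> pclosed (S :\: F).
Proof.
move=> pS oF w v tw; rewrite !inE => /andP[_ vS]; rewrite (pS w v) // andbT.
apply/negP=> /oF[o oM /exitS_tgt xo]; have := xo v.
by rewrite -(outs_eq oM erefl) tw vS => /(_ erefl).
Qed.

Lemma pclosed_comps S Y : pclosed S -> Y \in comps S -> pclosed Y.
Proof.
move=> pS YS w v tw vY; have vS := subsetP (comps_subset YS) _ vY.
apply: comps_adj YS _ vY (pS _ _ tw vS); rewrite adj_sym; exact: wire_adj.
Qed.

(** A wire between two nodes of [S] stays within one component, so it can leave [Y] only by leaving
    [S]. *)
Lemma exitS_comps S Y w : Y \in comps S -> exitS Y w = exitS S w && (src C w \in Y).
Proof.
move=> YS; rewrite /exitS andbAC; have [sY|] := boolP (src C w \in Y); last by rewrite andbF.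
rewrite andbT (subsetP (comps_subset YS) _ sY) /=.
case tw : (tgt C w) => [v|] //; congr (~~ _); apply/idP/idP => [|vS].
  exact: subsetP (comps_subset YS) _.
exact: comps_adj YS (wire_adj tw) sY vS.
Qed.

(** Deleting [N] destroys its only exit [o] and frees the wires entering it, whose sources are in
    [S] by closure; [loopless] keeps [o] itself from being one of these. *)
Lemma exitS_del S N o w : pclosed S -> outs N = [set o] -> exitS S o ->
  exitS (S :\ N) w = (exitS S w && (w != o)) || (w \in ins N).
Proof.
move=> pS oN xo; have NS : N \in S by rewrite -(outs_src oN); case/andP: xo.
have [->|wo] := eqVneq w o.
  rewrite /exitS !inE (outs_src oN) eqxx andbF /=.
  by apply/esym; have := loopless o; rewrite (outs_src oN) => /negPf.
have sN : src C w != N by apply: contra_neq wo; apply: outs_eq.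
rewrite /exitS !inE sN andbT /=; case tw : (tgt C w) => [v|]; last by rewrite orbF.
rewrite !inE (inj_eq Some_inj); case: eqP => [vN|_] /=; last by rewrite orbF.
by rewrite orbT andbT (pS _ _ tw) // vN.
Qed.

Lemma enumerates_del S N o e0 s : pclosed S -> outs N = [set o] -> exitS S o ->
  enumerates (rcons e0 o) S -> uniq s -> s =i ins N -> enumerates (e0 ++ s) (S :\ N).
Proof.
move=> pS oN xo [ue me] us ms; have NS : N \in S by rewrite -(outs_src oN); case/andP: xo.
move: ue; rewrite rcons_uniq => /andP[oe ue]; split.
  rewrite cat_uniq ue us andbT /=; apply/hasPn=> w; rewrite ms inE => /eqP tw.
  apply/negP=> we; have := me w; rewrite mem_rcons inE we orbT => /esym xw.
  by have := exitS_tgt xw tw; rewrite NS.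
move=> w; rewrite mem_cat ms (exitS_del w pS oN xo) -me mem_rcons inE; congr (_ || _).
by have [->|_] := eqVneq w o; rewrite ?(negPf oe) ?andbF ?andbT.
Qed.

(** Otherwise [Y] would be closed under adjacency in [S], since the only wire leaving [N] exits [S],
    and connectedness of [S] would put [N] in [Y]. *)
Lemma comps_del_touch S N o Y : conn S -> outs N = [set o] -> exitS S o ->
  Y \in comps (S :\ N) -> exists2 w, tgt C w = Some N & src C w \in Y.
Proof.
move=> [_ cS] oN xo YS; have NS : N \in S by rewrite -(outs_src oN); case/andP: xo.
have [/exists_inP[w /eqP tw sw]|nt] := boolP [exists (w | tgt C w == Some N), src C w \in Y].
  by exists w.
have nadj x : x \in Y -> ~~ adj x N.
  move=> xY; apply/existsP=> -[w /orP[] /andP[/eqP sw /eqP tw]].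
    by case/negP: nt; apply/exists_inP; exists w; rewrite ?tw ?sw.
  have := exitS_tgt xo; rewrite -(outs_eq oN sw) => /(_ _ tw).
  by case/negP; have := subsetP (comps_subset YS) _ xY; rewrite inE => /andP[].
have [/set0Pn[u uY] _] := comps_conn YS.
have uS : u \in S by have := subsetP (comps_subset YS) _ uY; rewrite inE => /andP[].
have clY x y : x \in Y -> adj x y -> y \in S -> y \in Y.
  move=> xY xy yS; apply: (comps_adj YS xy xY); rewrite !inE yS andbT.
  by apply/eqP=> yN; have := nadj _ xY; rewrite -yN xy.
have cl : closed (adjS S) (mem Y).
  move=> x y /and3P[xS yS xy]; apply/idP/idP => h; first exact: clY xy yS.
  by apply: (clY y) => //; rewrite adj_sym.
have := closed_connect cl (cS _ _ uS NS); rewrite uY => /esym NY.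
by have := subsetP (comps_subset YS) _ NY; rewrite !inE eqxx.
Qed.

Lemma comps1_eq S Y : comps S = [set Y] -> Y = S.
Proof.
move=> cS; have YS : Y \in comps S by rewrite cS inE.
apply/eqP; rewrite eqEsubset (comps_subset YS); apply/subsetP=> x xS.
by have := comp_comps xS; rewrite cS inE => /eqP <-; apply: comp_refl.
Qed.

Lemma comps2_eq S X Y : comps S = [set X; Y] -> S = X :|: Y.
Proof.
move=> cS; apply/eqP; rewrite eqEsubset; apply/andP; split.
  apply/subsetP=> x xS; have := comp_comps xS; rewrite cS !inE.
  by case/orP=> /eqP <-; rewrite comp_refl ?orbT.
by rewrite subUset; apply/andP; split; apply: comps_subset; rewrite cS !inE eqxx ?orbT.
Qed.

Lemma comps_disjoint S X Y v : comps S = [set X; Y] -> X != Y -> v \in X -> v \notin Y.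
Proof.
move=> cS XY vX; apply: contraNN XY => vY; apply/eqP.
by apply: (comps_inj (S := S) _ _ vX vY); rewrite cS !inE eqxx ?orbT.
Qed.

(** Brings the exit of the ready node to the last place, where the par, plus and with rules create
    it. *)
Lemma enumerates_rem S e o : o \in e -> enumerates e S -> enumerates (rcons (rem o e) o) S.
Proof.
by move=> oe; apply: enumerates_perm; rewrite perm_sym perm_rcons perm_sym perm_to_rem.
Qed.

(** Quantified over all exit orders, so that an induction hypothesis can be used for the order that
    the rule expects of its premise. *)
Let seqS S := forall e, enumerates e S -> sequentialized S e (map (lab C) e).

(** * Sequentialization by the kind of the ready node *)

Lemma seq_ax S N : kind C N = NAx -> S = [set N] -> seqS S.
Proof.
move=> kN -> e en; have := wfC N; rewrite /wf_node kN => -[_ [w1 [w2 [a [w12 [oN [l1 l2]]]]]]].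
have mo w : (w \in [:: w1; w2]) = (src C w == N).
  have : (w \in outs N) = (src C w == N) by rewrite inE.
  by rewrite oN !inE.
have en' : enumerates [:: w1; w2] [set N].
  split=> [|w]; first by rewrite /= inE w12.
  (* A wire from [N] cannot enter [N], so both wires are exits of the one-node set. *)
  rewrite mo /exitS inE; case: eqP => //= sw; case tw : (tgt C w) => [v|] //.
  by rewrite inE; apply/esym; apply: contraNneq (loopless w) => vN; rewrite tw vN sw.
apply: (sequentialized_reorder en' en); rewrite /= l1 l2.
exists (pax dual a), (fun=> N), (fun b => if b then w2 else w1).
have s1 : src C w1 = N by apply/eqP; rewrite -mo !inE eqxx.
have s2 : src C w2 = N by apply/eqP; rewrite -mo !inE eqxx orbT.
split=> //=.
- by move=> [] [].
- by move=> [] [] // /eqP; rewrite ?(negPf w12) // eq_sym (negPf w12).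
- by move=> _; rewrite inE.
- by move=> v; rewrite inE => /eqP ->; exists tt.
- by move=> w; rewrite inE -mo !inE => /orP[] /eqP ->; [exists false | exists true].
- by case.
- by case.
- by case=> _; rewrite -(proj2 en') !inE eqxx ?orbT.
Qed.

Lemma seq_plus S N : pclosed S -> conn S -> N \in finals S -> kind C N = NPlus ->
  (forall Y, Y \in comps (S :\ N) -> seqS Y) -> seqS S.
Proof.
move=> pS cS NF kN IH e en.
have [o oN] : exists o, outs N = [set o] by apply: single_out; rewrite kN.
have xo := final_exit oN NF; have oe : o \in e by rewrite (proj2 en).
have en0 := enumerates_rem oe en; set e0 := rem o e in en0.
apply: (sequentialized_reorder en0 en).
have := wfC N; rewrite /wf_node kN => -[w [o' [B [iN [oN' lo]]]]].
have ? : o' = o by apply: (outs_eq oN); apply: outs_src oN'.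
subst o'; have tw : tgt C w = Some N by have := set11 w; rewrite -iN inE => /eqP.
have NS := finals_sub NF.
have sw : src C w \in S :\ N.
  rewrite !inE (pS _ _ tw NS) andbT.
  by apply/eqP=> sN; have := loopless w; rewrite tw sN eqxx.
(* Every component contains the source of a wire entering [N]; as there is one such wire, there is
   one component. *)
have cN : comps (S :\ N) = [set S :\ N].
  suff all Y : Y \in comps (S :\ N) -> Y = Defs.comp (S :\ N) (src C w).
    have eq : comps (S :\ N) = [set Defs.comp (S :\ N) (src C w)].
      apply/setP=> Y; rewrite inE; apply/idP/eqP => [/all //|->]; exact: comp_comps.
    by rewrite eq (comps1_eq eq).
  move=> YS; have [w' tw' sY] := comps_del_touch cS oN xo YS.
  have -> : w = w' by apply/esym/set1P; rewrite -iN inE tw'.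
  exact: comps_eq YS sY.
have en1 : enumerates (rcons e0 w) (S :\ N).
  by rewrite -cats1; apply: enumerates_del en0 _ _ => // x; rewrite iN !inE.
have [|pi [fN [fW rz]]] := IH (S :\ N) _ _ en1; first by rewrite cN inE.
move: pi fN fW rz; rewrite !map_rcons -!(cats1 (map (lab C) _)) lo.
have SN : N |: (S :\ N) = S by rewrite setD1K.
have ex : {in rcons e0 o, forall x, exitS (N |: S :\ N) x} by move=> x; rewrite SN (proj2 en0).
(* A left premise is the case [b = false], since [plus_circ] designates the wire by [~~ b]. *)
case lw : (isleft C w) => pi fN fW rz.
  exists (@pplus _ _ _ (lab C w) B false pi), (oapp fN N), (oapp fW o).
  rewrite -SN /= size_map; apply: (realizes_plus (b := false) rz en1 _ kN oN tw _ lw ex); rewrite ?setD11 ?lo ?lw //.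
exists (@pplus _ _ _ B (lab C w) true pi), (oapp fN N), (oapp fW o).
rewrite -SN /= size_map; apply: (realizes_plus (b := true) rz en1 _ kN oN tw _ lw ex); rewrite ?setD11 ?lo ?lw //.
Qed.

Lemma wf_bin N t : kind C N = NBin t ->
  exists wl wr o, [/\ outs N = [set o], ins N = [set wl; wr], isleft C wl, ~~ isleft C wr &
    [/\ tgt C wl = Some N, tgt C wr = Some N, wl != wr &
        lab C o = binf t (lab C wl) (lab C wr)]].
Proof.
move=> kN; have := wfC N; rewrite /wf_node kN => -[wl [wr [o [iN [ll [lr [oN lo]]]]]]].
exists wl, wr, o; split=> //; split=> //.
- by have := set21 wl wr; rewrite -iN inE => /eqP.
- by have := set22 wl wr; rewrite -iN inE => /eqP.
- by apply/eqP=> eq; rewrite -eq ll in lr.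
Qed.

Lemma seq_par S N : pclosed S -> conn S -> N \in finals S -> kind C N = NBin BPar ->
  #|comps (S :\ N)| = 1 -> (forall Y, Y \in comps (S :\ N) -> seqS Y) -> seqS S.
Proof.
move=> pS cS NF kN c1 IH e en.
have [wl [wr [o [oN iN ll lr [tl tr lr' lo]]]]] := wf_bin kN.
have xo := final_exit oN NF; have oe : o \in e by rewrite (proj2 en).
have en0 := enumerates_rem oe en; set e0 := rem o e in en0.
apply: (sequentialized_reorder en0 en).
have cN : comps (S :\ N) = [set S :\ N].
  by have /eqP/cards1P[Y eq] := c1; rewrite eq -(comps1_eq eq).
have en1 : enumerates (e0 ++ [:: wl; wr]) (S :\ N).
  by apply: enumerates_del en0 _ _ => // [|x]; rewrite ?iN /= !inE ?lr'.
have [|pi [fN [fW rz]]] := IH (S :\ N) _ _ en1; first by rewrite cN inE.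
move: pi fN fW rz; rewrite map_rcons map_cat -!(cats1 (map (lab C) _)) lo /= => pi fN fW rz.
have SN : N |: (S :\ N) = S by apply: setD1K; apply: finals_sub.
have ex : {in rcons e0 o, forall x, exitS (N |: S :\ N) x} by move=> x; rewrite SN (proj2 en0).
exists (ppar pi), (oapp fN N), (oapp fW o).
rewrite -SN /= size_map; apply: (realizes_par rz en1 _ kN oN tl tr lo ll lr ex).
by rewrite !inE eqxx.
Qed.

Lemma seq_tens S N : pclosed S -> conn S -> N \in finals S -> kind C N = NBin BTens ->
  #|comps (S :\ N)| = 2 -> (forall Y, Y \in comps (S :\ N) -> seqS Y) -> seqS S.
Proof.
move=> pS cS NF kN c2 IH e en.
have [wl [wr [o [oN iN ll lr [tl tr lr' lo]]]]] := wf_bin kN.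
have xo := final_exit oN NF; have oe : o \in e by rewrite (proj2 en).
have en0 := enumerates_rem oe en; set e0 := rem o e in en0.
have NS := finals_sub NF.
(* Each component sends a wire into [N], which receives just two, so each sends one; [Y1] names the
   component of the left premise. *)
have [Y1 [Y2 [cN Y12 s1 s2]]] : exists Y1 Y2, [/\ comps (S :\ N) = [set Y1; Y2], Y1 != Y2,
    src C wl \in Y1 & src C wr \in Y2].
  have /eqP/cards2P[X1 [X2 [X12 cX]]] := c2.
  have [|v1 t1 v1X] := @comps_del_touch S N o X1 cS oN xo; first by rewrite cX !inE eqxx.
  have [|v2 t2 v2X] := @comps_del_touch S N o X2 cS oN xo; first by rewrite cX !inE eqxx orbT.
  have : v1 \in ins N by rewrite inE t1.
  have : v2 \in ins N by rewrite inE t2.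
  rewrite iN !inE => /orP[]/eqP ? /orP[]/eqP ?; subst v1 v2.
  - by have := comps_disjoint cX X12 v1X; rewrite v2X.
  - by exists X2, X1; rewrite eq_sym cX setUC.
  - by exists X1, X2.
  - by have := comps_disjoint cX X12 v1X; rewrite v2X.
have dis v : v \in Y1 -> v \notin Y2 by apply: (comps_disjoint cN Y12).
have dis' v : v \in Y2 -> v \notin Y1 by move=> v2; apply/negP=> /dis; rewrite v2.
have U12 := comps2_eq cN.
have Y1c : Y1 \in comps (S :\ N) by rewrite cN !inE eqxx.
have Y2c : Y2 \in comps (S :\ N) by rewrite cN !inE eqxx orbT.
have [ue me] : enumerates (e0 ++ [:: wl; wr]) (S :\ N).
  by apply: enumerates_del en0 _ _ => // [|x]; rewrite ?iN /= !inE ?lr'.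
move: ue; rewrite cat_uniq /= => /and3P[ue0 /norP[nl /norP[nr _]] _].
(* The remaining exits are shared out according to the component they start from. *)
pose e1 := [seq w <- e0 | src C w \in Y1]; pose e2 := [seq w <- e0 | src C w \in Y2].
have en1 : enumerates (rcons e1 wl) Y1.
  split; first by rewrite rcons_uniq mem_filter (negPf nl) andbF filter_uniq.
  move=> w; rewrite (exitS_comps w Y1c) -me mem_rcons mem_cat !inE mem_filter.
  have [->|wl'] := eqVneq w wl; first by rewrite s1 orbT.
  have [->|_] /= := eqVneq w wr; first by rewrite (negPf (dis' _ s2)) andbF.
  by rewrite orbF andbC.
have en2 : enumerates (wr :: e2) Y2.
  split; first by rewrite /= mem_filter (negPf nr) andbF filter_uniq.
  move=> w; rewrite (exitS_comps w Y2c) -me mem_cat !inE mem_filter.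
  have [->|_] := eqVneq w wr; first by rewrite s2 !orbT.
  have [->|_] /= := eqVneq w wl; first by rewrite (negPf (dis _ s1)) andbF.
  by rewrite orbF andbC.
have srcY w : w \in e0 -> (src C w \in Y1) || (src C w \in Y2).
  move=> we; have := me w; rewrite mem_cat we => /esym/andP[+ _].
  by rewrite U12 inE.
(* This is the order produced by the tensor rule. It is a permutation of [rcons e0 o] because [e2]
   is the complement of [e1] in [e0]. *)
have en3 : enumerates (e1 ++ o :: e2) S.
  have E2 : e2 = [seq w <- e0 | predC (fun w => src C w \in Y1) w].
    apply: eq_in_filter => w /srcY /= /orP[sY|sY]; first by rewrite sY (negPf (dis _ sY)).
    by rewrite sY dis'.
  apply: enumerates_perm en0; rewrite perm_rcons.
  apply: (@perm_trans _ (o :: e1 ++ e2)); last first.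
    by rewrite perm_sym (perm_catCA e1 [:: o] e2).
  by rewrite perm_cons E2 perm_sym perm_filterC.
apply: (sequentialized_reorder en3 en).
have [pi1 [f1 [g1 rz1]]] := IH _ Y1c _ en1; have [pi2 [f2 [g2 rz2]]] := IH _ Y2c _ en2.
have SN : N |: (Y1 :|: Y2) = S by rewrite -U12 setD1K.
have N1 : N \notin Y1 by apply/negP=> /(subsetP (comps_subset Y1c)); rewrite !inE eqxx.
have N2 : N \notin Y2 by apply/negP=> /(subsetP (comps_subset Y2c)); rewrite !inE eqxx.
move: pi1 f1 g1 rz1 pi2 f2 g2 rz2.
rewrite map_cat map_rcons /= -!(cats1 (map (lab C) _)) lo => pi1 f1 g1 rz1 pi2 f2 g2 rz2.
exists (ptens pi1 pi2), (tens_map f1 f2 N), (tens_map g1 g2 o).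
rewrite -SN /= size_map; apply: (realizes_tens rz1 en1 rz2 en2 dis N1 N2 kN oN tl tr lo ll lr).
by move=> w; rewrite SN (proj2 en3).
Qed.

(** Every exit of [X] enters a final node, for a wire exiting [S] would make its source final. A
    final node receives exactly one wire from [X] and has exactly one exit, so the exits of [S] and
    those of [X] correspond through [h]. *)
Lemma with_side S X X' e :
    comps (S :\: finals S) = [set X; X'] -> X != X' ->
    {in finals S, forall M, exists w w', [/\ tgt C w = Some M, tgt C w' = Some M,
       src C w \in X & src C w' \in X']} ->
    {in finals S, forall M, exists a b, ins M = [set a; b]} ->
    {in finals S, forall M, exists o, outs M = [set o]} ->
    enumerates e S ->
  exists h, [/\ {in e, forall q, tgt C (h q) = Some (src C q)},
    {in e, forall q, src C (h q) \in X},
    forall q w, q \in e -> tgt C w = Some (src C q) -> src C w \in X -> h q = w &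
    enumerates (map h e) X].
Proof.
move=> cX XX' hM insM outsM [ue me].
have Xc : X \in comps (S :\: finals S) by rewrite cX !inE eqxx.
have fin q : q \in e -> src C q \in finals S.
  by rewrite me inE => xq; apply/existsP; exists q; rewrite xq eqxx.
have XF v : v \in X -> v \notin finals S.
  by move=> vX; have := subsetP (comps_subset Xc) _ vX; rewrite !inE => /andP[].
(* A final node has at most two incoming wires, and [u'] comes from the other side. *)
have only M w w' : M \in finals S -> tgt C w = Some M -> tgt C w' = Some M ->
    src C w \in X -> src C w' \in X -> w = w'.
  move=> MF tw tw' sw sw'; have [u [u' [tu tu' su su']]] := hM _ MF.
  have [a [b iM]] := insM _ MF.
  have mem x : tgt C x = Some M -> (x == a) || (x == b).
    by move=> tx; have : x \in ins M by [rewrite inE tx]; rewrite iM !inE.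
  have nu x : src C x \in X -> x <> u'.
    by move=> sx xu; have := comps_disjoint cX XX' sx; rewrite xu su'.
  have := nu _ sw; have := nu _ sw'.
  by case/orP: (mem _ tw) => /eqP->; case/orP: (mem _ tw') => /eqP->;
    case/orP: (mem _ tu') => /eqP->.
(* The default [q] is never reached on [e], where [hM] provides a wire. *)
pose h q := odflt q [pick w | (tgt C w == Some (src C q)) && (src C w \in X)].
have hP q : q \in e -> tgt C (h q) = Some (src C q) /\ src C (h q) \in X.
  move=> qe; rewrite /h; case: pickP => [w /andP[/eqP] //|none].
  have [w [_ [tw _ sw _]]] := hM _ (fin _ qe).
  by have := none w; rewrite tw sw eqxx.
have hU q w : q \in e -> tgt C w = Some (src C q) -> src C w \in X -> h q = w.
  by move=> qe tw sw; have [th sh] := hP _ qe; apply: (only (src C q)); rewrite ?fin.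
exists h; split=> //; try by move=> q /hP[].
split.
  rewrite map_inj_in_uniq // => q q' qe qe' hq.
  have [+ _] := hP _ qe; have [+ _] := hP _ qe'; rewrite hq => -> [sq].
  by have [o oM] := outsM _ (fin _ qe); rewrite (outs_eq oM erefl) (outs_eq oM sq).
move=> w; rewrite (exitS_comps w Xc); apply/mapP/idP => [[q qe ->]|/andP[xw sw]].
  have [th sh] := hP _ qe; rewrite /exitS th sh (subsetP (comps_subset Xc) _ sh) /=.
  by rewrite in_setD fin.
have sS : src C w \in S by have := subsetP (comps_subset Xc) _ sw; rewrite inE => /andP[].
have nx : ~~ exitS S w.
  by apply: contra (XF _ sw) => xw'; rewrite inE; apply/existsP; exists w; rewrite xw' eqxx.
move: nx; rewrite /exitS sS /=; case tw : (tgt C w) => [v|] //; rewrite negbK => vS.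
have := exitS_tgt xw tw; rewrite inE vS andbT negbK => vF.
have [q oq] := outsM _ vF; have qe : q \in e by rewrite me (final_exit oq vF).
by exists q => //; apply/esym/hU; rewrite ?(outs_src oq).
Qed.

(** Both premises are enumerated along the same list [e0], and contraction nodes preserve labels, so
    the two contexts agree as [pwith] requires. *)
Lemma seq_with_oriented S N X1 X2 wl wr o :
    N \in finals S -> kind C N = NBin BWith ->
    (forall M, M \in finals S -> M != N -> kind C M = NContr) ->
    outs N = [set o] -> isleft C wl -> ~~ isleft C wr ->
    tgt C wl = Some N -> tgt C wr = Some N -> src C wl \in X1 -> src C wr \in X2 ->
    lab C o = With (lab C wl) (lab C wr) ->
    comps (S :\: finals S) = [set X1; X2] -> X1 != X2 ->
    {in finals S, forall M, exists w w', [/\ tgt C w = Some M, tgt C w' = Some M,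
       src C w \in X1 & src C w' \in X2]} ->
  seqS X1 -> seqS X2 -> seqS S.
Proof.
move=> NF kN kC oN ll lr tl tr sl sr lo cX X12 hM IH1 IH2 e en.
have xo := final_exit oN NF; have oe : o \in e by rewrite (proj2 en).
have en0 := enumerates_rem oe en; set e0 := rem o e in en0.
apply: (sequentialized_reorder en0 en).
have so := outs_src oN.
have insM : {in finals S, forall M, exists a b, ins M = [set a; b]}.
  move=> M MF; have [->|/(kC _ MF) kM] := eqVneq M N.
    by have [a [b [c [_ iN _ _ _]]]] := wf_bin kN; exists a, b.
  by have := wfC M; rewrite /wf_node kM => -[a [b [c [_ [iM _]]]]]; exists a, b.
have outsM : {in finals S, forall M, exists o, outs M = [set o]}.
  by move=> M MF; apply: single_out; have [->|/(kC _ MF) ->] := eqVneq M N; rewrite ?kN.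
have fin q : q \in rcons e0 o -> src C q \in finals S.
  by rewrite (proj2 en0) inE => xq; apply/existsP; exists q; rewrite xq eqxx.
have oin : o \in rcons e0 o by rewrite mem_rcons inE eqxx.
have ein q : q \in e0 -> q \in rcons e0 o by rewrite mem_rcons inE orbC => ->.
have hM' : {in finals S, forall M, exists w w', [/\ tgt C w = Some M, tgt C w' = Some M,
    src C w \in X2 & src C w' \in X1]}.
  by move=> M /hM[w [w' [? ? ? ?]]]; exists w', w.
have cX' : comps (S :\: finals S) = [set X2; X1] by rewrite setUC.
have X21 : X2 != X1 by rewrite eq_sym.
have [h1 [t1 s1 u1 en1]] := with_side cX X12 hM insM outsM en0.
have [h2 [t2 s2 u2 en2]] := with_side cX' X21 hM' insM outsM en0.
(* At [o] the two selected wires are the premises of [N] itself. *)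
move: en1 en2; rewrite !map_rcons (u1 o wl) ?(u2 o wr) ?so // => en1 en2.
have kc : {in e0, forall q, kind C (src C q) = NContr}.
  move=> q qe; apply: kC; rewrite ?fin ?ein //; apply/eqP=> /(outs_eq oN) qo.
  by case: en0; rewrite rcons_uniq -qo qe.
have labh h : {in rcons e0 o, forall q, tgt C (h q) = Some (src C q)} ->
    map (lab C) (map h e0) = map (lab C) e0.
  move=> th; rewrite -map_comp; apply/eq_in_map => q qe /=.
  have := wfC (src C q); rewrite /wf_node kc // => -[a [b [c [_ [iq [oq [la lb]]]]]]].
  have : h q \in ins (src C q) by rewrite inE th ?ein.
  by rewrite iq !inE => /orP[] /eqP ->; rewrite ?la ?lb -(outs_eq oq (erefl (src C q))).
have S12 := comps2_eq cX.
have [pi1 [f1 [g1 rz1]]] := IH1 _ en1; have [pi2 [f2 [g2 rz2]]] := IH2 _ en2.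
move: pi1 f1 g1 rz1 pi2 f2 g2 rz2.
rewrite !map_rcons !labh // -!(cats1 (map (lab C) e0)) lo => pi1 f1 g1 rz1 pi2 f2 g2 rz2.
exists (pwith pi1 pi2), (with_nmap f1 f2 (fun j => src C (nth o e0 j)) N),
  (with_wmap g1 g2 (fun j => nth o e0 j) o).
have nS v : v \in X1 :|: X2 -> v \notin finals S by rewrite -S12 inE => /andP[].
apply: (realizes_with rz1 en1 rz2 en2 _ en0 _ kc so kN _ _ _ _ _ tl tr lo ll lr).
- by move=> v; apply: comps_disjoint cX X12.
- by move=> q /fin /outsM[q' oq]; rewrite oq -(outs_eq oq (erefl (src C q))).
- move=> v; split=> [vS|[vX|vX|[q + ->]]].
  + have [/[dup] vF /outsM[q oq]|vF] := boolP (v \in finals S).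
      constructor 3; exists q; last by rewrite (outs_src oq).
      by rewrite (proj2 en0) (final_exit oq vF).
    have : v \in X1 :|: X2 by rewrite -S12 inE vF.
    by rewrite inE => /orP[]; [constructor 1 | constructor 2].
  + by have : v \in X1 :|: X2 by [rewrite inE vX]; rewrite -S12 inE => /andP[].
  + by have : v \in X1 :|: X2 by [rewrite inE vX orbT]; rewrite -S12 inE => /andP[].
  + by rewrite (proj2 en0) => /andP[].
- by move=> q /fin; apply: contraL => qX; apply: nS; rewrite inE qX.
- by move=> q /fin; apply: contraL => qX; apply: nS; rewrite inE qX orbT.
- by move=> q /ein /t1.
- by move=> q /ein /t2.
Qed.

(** Readiness does not tell which component holds the left premise, so [X1] and [X2] are swapped
    when it starts in [X2]. *)
Lemma seq_with S N X1 X2 : N \in finals S -> kind C N = NBin BWith ->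
    (forall M, M \in finals S -> M != N -> kind C M = NContr) ->
    comps (S :\: finals S) = [set X1; X2] -> X1 != X2 ->
    {in finals S, forall M, exists w w', [/\ tgt C w = Some M, tgt C w' = Some M,
       src C w \in X1 & src C w' \in X2]} ->
  seqS X1 -> seqS X2 -> seqS S.
Proof.
move=> NF kN kC cX X12 hM IH1 IH2.
have [wl [wr [o [oN iN ll lr [tl tr _ lo]]]]] := wf_bin kN.
have [w1 [w2 [t1 t2 s1 s2]]] := hM _ NF.
have : w1 \in ins N by rewrite inE t1.
have : w2 \in ins N by rewrite inE t2.
have n12 : w1 <> w2 by move=> eq; have := comps_disjoint cX X12 s1; rewrite eq s2.
rewrite iN !inE => /orP[]/eqP ? /orP[]/eqP ?; subst w1 w2 => //.
  apply: (seq_with_oriented NF kN kC oN ll lr tl tr s2 s1 lo) => //.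
  - by rewrite setUC.
  - by rewrite eq_sym.
  - by move=> M /hM[w [w' [? ? ? ?]]]; exists w', w.
exact: (seq_with_oriented NF kN kC oN ll lr tl tr s1 s2 lo).
Qed.

(** Closure under predecessors and connectedness pass to the components left by a step, which keeps
    the induction hypothesis applicable. *)
Lemma erases_sequentialized S : erases S -> pclosed S -> conn S -> seqS S.
Proof.
elim=> {}S N R [NF rdy] _ IH pS cS.
have out_exit M : M \in finals S -> kind C M <> NAx ->
    exists2 o, outs M = [set o] & exitS S o.
  by move=> MF /single_out[o oM]; exists o; rewrite ?(final_exit oM).
(* Here [F] is either a single ready node or the whole final layer, so both forms of deletion are
   covered. *)
have IHc F : {in F : {set node C}, forall M, exists2 o, outs M = [set o] & exitS S o} ->
    comps (S :\: F) = R -> forall Y, Y \in comps (S :\: F) -> seqS Y.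
  move=> oF cR Y YS; apply: IH; rewrite -?cR //.
    exact: pclosed_comps (pclosedD pS oF) YS.
  exact: comps_conn YS.
have IH1 : kind C N <> NAx -> comps (S :\ N) = R ->
    forall Y, Y \in comps (S :\ N) -> seqS Y.
  by move=> kN; apply: IHc => M /set1P ->; apply: out_exit.
case kN : (kind C N) rdy IH1 => [||[]|] // rdy IH1.
- by case: rdy => SN _; apply: (seq_ax kN).
- by case: rdy => c2 cR; apply: (seq_tens pS cS NF kN c2); apply: IH1.
- by case: rdy => c1 cR; apply: (seq_par pS cS NF kN c1); apply: IH1.
- case: rdy => kC [X1 [X2 [X12 [cX [hM RX]]]]].
  have {}IH Y : Y \in [set X1; X2] -> seqS Y.
    rewrite -cX; apply: IHc; last by rewrite RX.
    move=> M MF; apply: out_exit => //.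
    by have [->|/(kC _ MF) ->] := eqVneq M N; rewrite ?kN.
  apply: (seq_with NF kN kC cX X12); try by apply: IH; rewrite !inE eqxx ?orbT.
  by move=> M /hM[w [w' [? [? [? ?]]]]]; exists w, w'.
- by apply: (seq_plus pS cS NF kN); apply: IH1.
Qed.

End Sequentialization.

(** * From node sets back to circuits *)

Lemma wf_erasable_sequentializable (L : Type) (dual : L -> L) (C : circuit L) :
  wf_circuit dual C -> erasable C -> sequentializable dual C.
Proof.
move=> [cN [ll [ue [me [wfn con]]]]] /erasableP er.
have cT : conn [set: node C].
  split; first by rewrite -card_gt0 cardsT.
  by move=> u v _ _; apply: connect_sub (con u v) => x y xy; apply: connect1; rewrite /adjS !inE.
have xT w : exitS setT w = (tgt C w == None).
  by rewrite /exitS inE; case: (tgt C w) => // v; rewrite inE.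
have en : enumerates (exits C) [set: node C] by split=> // w; rewrite xT.
have pT : pclosed [set: node C] by move=> *; rewrite inE.
have [pi [fN [fW rz]]] := erases_sequentialized ll wfn er pT cT en.
have bij (T U : finType) (f : T -> U) : injective f -> (forall y, exists x, y = f x) -> bijective f.
  move=> fI fS; apply: inj_card_bij => //.
  rewrite -(card_codom fI); apply: subset_leq_card; apply/subsetP=> y _.
  by have [x ->] := fS y; apply: codom_f.
exists _, pi, fN, fW; split.
  by apply: bij => [|v]; [apply: rz_injN rz | apply: rz_ontoN rz _ _].
split; first by apply: bij => [|w]; [apply: rz_injW rz | apply: rz_ontoW rz _ _].
split; first exact: rz_kind rz.
split; first exact: rz_lab rz.
split; first exact: rz_src rz.
split; last by split; [apply: rz_left rz | rewrite (rz_exits rz)].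
move=> w; case tw : (tgt _ w) => [v|]; first exact: rz_tgt rz _ _ tw.
(* On the whole node set an exit is a wire without target, so exits of the translation are sent to
   exits of [C]. *)
by have := rz_exit rz tw; rewrite xT => /eqP.
Qed.

Unset Implicit Arguments.

Theorem mainTheorem4 (L : Type) (dual : L -> L)
    (dual_invol : forall a, dual (dual a) = a)
    (dual_neq : forall a, dual a <> a) :
  (forall C : circuit L, wf_circuit dual C ->
     (erasable C <-> sequentializable dual C)) /\
  (forall (G : seq (formula L)) (pi : proof dual G),
     erasable (translate pi)).
Proof.
have er (G : seq (formula L)) (pi : proof dual G) : erases [set: node (translate pi)].
  exact: coh_erases (coh_translate pi).
split=> [C wfC|G pi]; last exact/erasableP/er.
split; first exact: wf_erasable_sequentializable.
by case=> G [pi iso]; apply/erasableP/(circ_iso_erases iso)/er.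
Qed.
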